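(* Let $G$ be a locally compact group with modular function $\Delta$ and right Haar measure $\rho$, and let $G\curvearrowright (X,\mu)$ be an action on a measured space leaving $\mu$ $\Delta$-relatively invariant. Let $(G_n)_{n\in\mathbb{N}}$ be an increasing sequence of closed subgroups of $G$ whose union is dense in $G$ and which satisfies the modular condition (MC). Let $\rho_n$ be a right Haar measure of $G_n$, and assume that the sequence $(\rho_n)$ is normalized with respect to $\rho$. The following two properties are equivalent: (a) $X$ is a countable union of Borel subsets $B_k$ of finite $\mu$-measure such that, for every $k$ and $\mu$-almost every $x\in X$, $$\rho(\{t\in G : tx\in B_k\}) = \int_G \mathbf{1}_{B_k}(tx)\, d\rho(t) <+\infty.$$ (b) For every $f\in L^1(X,\mu)$ and for $\mu$-almost every $x\in X$, $$\lim_{n\to\infty} \int_{G_n} f(tx)\, d\rho_n(t) = \int_{G} f(tx)\, d\rho(t)$$ (where it is part of the assertion that, for almost every $x$, the function $t\mapsto f(tx)$ is $\rho_n$-integrable on $G_n$ for every $n$ and $\rho$-integrable on $G$).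
   Context: Locally compact groups are assumed Hausdorff and $\sigma$-compact. A measured space $(X,\mu)$ is a standard Borel space with a non-negative $\sigma$-finite measure $\mu$. The modular function $\Delta$ of $G$ is defined by $\lambda=\Delta\rho$, where $\lambda,\rho$ are (suitably normalized) left and right Haar measures of $G$; equivalently $\lambda(As)=\Delta(s)\lambda(A)$. An action of $G$ on $(X,\mu)$ is a Borel map $G\times X\to X$, $(t,x)\mapsto tx$, which is a left action and leaves $\mu$ quasi-invariant. The measure $\mu$ is $\Delta$-relatively invariant if $s\mu=\Delta(s)\mu$ for all $s\in G$, where $s\mu(A)=\mu(s^{-1}A)$ is the push-forward (for example, $\rho$ under left translation of $G$ on itself). The sequence $(G_n)$ satisfies the modular condition (MC) if, for every $n$, the modular function of $G_n$ is the restriction of $\Delta$ to $G_n$. The sequence $(\rho_n)$ is normalized with respect to $\rho$ if $\lim_n\int_{G_n} f\,d\rho_n=\int_G f\,d\rho$ for every continuous function $f$ on $G$ with compact support. *)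

(* Defs.v *)
From HB Require Import structures.
From mathcomp Require Import all_boot all_order all_algebra.
From mathcomp Require Import all_classical all_reals all_analysis.

Set Implicit Arguments.
Unset Strict Implicit.
Unset Printing Implicit Defensive.

Import Order.TTheory GRing.Theory Num.Theory.
Import numFieldNormedType.Exports.

Local Open Scope classical_set_scope.
Local Open Scope ring_scope.
Local Open Scope ereal_scope.

HB.mixin Record PTopologicalGroup_isTopologicalGroup G
    & PointedTopological G & Group G := {
  mulg_continuous : continuous (fun z : G * G => (z.1 * z.2)%g) ;
  invg_continuous : continuous (fun x : G => x^-1%g)
}.

(* The distinguished point (unrelated to the group structure) is only there
   because measurable types are pointed. *)
#[short(type="topologicalGroupType")]
HB.structure Definition TopologicalGroup :=
  {G of PointedTopological G & Group G
      & PTopologicalGroup_isTopologicalGroup G}.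

Notation borel G := (g_sigma_algebraType (@open G)).

Definition sigma_compact (T : topologicalType) :=
  exists2 K : nat -> set T, forall k, compact (K k) & \bigcup_k K k = [set: T].

Definition locally_compact_group (G : topologicalGroupType) :=
  [/\ hausdorff_space G, locally_compact [set: G] & sigma_compact G].

Definition closed_subgroup (G : topologicalGroupType) (H : set G) :=
  closed H /\ group_closed [in H].

Section haar.
Context (R : realType) (G : topologicalGroupType).

(* A Radon measure on a closed subgroup H is encoded by its extension by zero
   to the Borel sets of G: since H is closed, the Borel sets of H are the Borel
   sets of G that are included in H, and this encoding is one-to-one. Nonzero
   Radon measures only. *)
Record radon_measure_on (H : set G) (m : {measure set (borel G) -> \bar R}) :
    Prop := {
  radon_supported : m (~` H) = 0 ;
  radon_neq0 : m H != 0 ;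
  radon_compact : forall K : set G, compact K -> m K < +oo ;
  radon_outer : forall A : set (borel G), measurable A ->
    m A = ereal_inf [set m U | U in [set U : set G | open U /\ A `<=` U]] ;
  radon_inner : forall U : set G, open U ->
    m U = ereal_sup [set m K | K in [set K : set G | compact K /\ K `<=` U]]
}.

Definition left_haar_measure (H : set G)
    (m : {measure set (borel G) -> \bar R}) :=
  radon_measure_on H m /\
  forall (s : G) (A : set (borel G)), H s -> measurable A ->
    m [set (s * t)%g | t in A] = m A.

Definition right_haar_measure (H : set G)
    (m : {measure set (borel G) -> \bar R}) :=
  radon_measure_on H m /\
  forall (s : G) (A : set (borel G)), H s -> measurable A ->
    m [set (t * s)%g | t in A] = m A.

(* Left Haar measures of H exist and are unique up to a positive factor, so that
   this determines D on H. Only the values of D on H are involved, hence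
   [modular_function H D] also says that the modular function of H is the
   restriction of D to H. *)
Definition modular_function (H : set G) (D : G -> R) :=
  forall lambda : {measure set (borel G) -> \bar R},
    left_haar_measure H lambda ->
    forall (s : G) (A : set (borel G)), H s -> measurable A ->
      lambda [set (t * s)%g | t in A] = (D s)%:E * lambda A.

Definition normalized (H : nat -> set G)
    (rho_ : nat -> {measure set (borel G) -> \bar R})
    (rho : {measure set (borel G) -> \bar R}) :=
  forall f : G -> R, continuous f -> compact (closure [set t | f t != 0%R]) ->
    \int[rho_ n]_(t in H n) (f t)%:E @[n --> \oo] --> \int[rho]_t (f t)%:E.

End haar.

Definition polish_space (R : realType) (P : completePseudoMetricType R) :=
  hausdorff_space P /\ exists2 D : set P, countable D & dense D.

(* Borel isomorphic to a Polish space *)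
Definition standard_borel (R : realType) (d : measure_display)
    (X : measurableType d) :=
  exists (P : completePseudoMetricType R) (f : X -> P),
    [/\ polish_space P, bijective f &
        @measurable d X
        = preimage_set_system setT f (@open P).-sigma.-measurable].

Section actions.
Context (R : realType) (G : topologicalGroupType) (d : measure_display).
Context (X : measurableType d) (mu : {measure set X -> \bar R}).

Record measured_action (act : G -> X -> X) : Prop := {
  action_borel : measurable_fun [set: borel G * X]
    (fun z : borel G * X => act z.1 z.2) ;
  action1 : forall x, act 1%g x = x ;
  actionM : forall s t x, act (s * t)%g x = act s (act t x) ;
  action_quasi_invariant : forall s : G,
    pushforward mu (act s) `<< mu /\ mu `<< pushforward mu (act s)
}.

Definition relatively_invariant (D : G -> R) (act : G -> X -> X) :=
  forall (s : G) (A : set X), measurable A ->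
    pushforward mu (act s) A = (D s)%:E * mu A.

End actions.

(* Main.v *)
(* The equivalence is reduced to the translation action of G on itself.

   For f in L^1(rho), the averages Phi_n f(s) = \int f(ts) d rho_n(t) converge
   to \int f d rho for rho-almost every s: this is the normalization hypothesis
   when f is continuous with compact support, such functions are dense in
   L^1(rho), and the convergence passes to the limit thanks to the maximal
   inequality
     lam * \int_E h <= \int f,
     E = {exists n, 0 < Phi_n h < oo and lam * Phi_n h < Phi_n f},
   applied with h continuous with compact support, for which sup_n Phi_n h(s) is
   finite. That inequality is the one of a reverse martingale; it follows from
   the G_n-invariance of Phi_n f, which makes it possible to split E along the
   last n at which the threshold is exceeded, and from the self-adjointness
     \int g (Phi_n f) = \int f (Phi_n g),
   which is where the modular condition is used.

   For f in L^1(X, mu), property (a) and the same self-adjointness, for G acting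
   on X, show that t |-> f(tx) is rho-integrable for almost every x. The
   convergence on G, applied to this function, gives the convergence at sx for
   almost every (s, x), hence for some s and almost every x, and mu is
   quasi-invariant. *)
Require Import Defs.
From HB Require Import structures.
From mathcomp Require Import all_boot all_order all_algebra.
From mathcomp Require Import all_classical all_reals all_analysis.
From mathcomp Require Import finmap ring lra measurable_realfun.

Set Implicit Arguments.
Unset Strict Implicit.
Unset Printing Implicit Defensive.

Import Order.TTheory GRing.Theory Num.Theory.
Import numFieldNormedType.Exports.

Local Open Scope classical_set_scope.
Local Open Scope ring_scope.
Local Open Scope ereal_scope.

(** * Continuous functions with compact support *)

Definition cc_fun (R : realType) (T : topologicalType) (f : T -> R) :=
  continuous f /\ compact (closure [set t | f t != 0%R]).

(* Urysohn's lemma is applied in the one-point compactification; truncating the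
   separating function at level 1/2 makes its support avoid the point at
   infinity, hence compact. *)
Lemma exists_cc_fun (R : realType) (T : topologicalType) (K U : set T) :
  hausdorff_space T -> locally_compact [set: T] ->
  compact K -> open U -> K `<=` U ->
  exists f : T -> R, [/\ cc_fun f, forall x, (0 <= f x <= 1)%R,
    forall x, K x -> f x = 1%R & forall x, ~ U x -> f x = 0%R].
Proof.
move=> hT lT cK oU KU.
pose opc := one_point_compactification T.
have hO : hausdorff_space opc by exact: one_point_compactification_hausdorff.
have nO : normal_space opc.
  by apply: compact_normal => //; exact: one_point_compactification_compact.
have someC : continuous (Some : T -> opc).
  exact: one_point_compactification_some_continuous.
pose A : set opc := Some @` K.
pose B : set opc := ~` (Some @` U).
have cA : closed A.
  apply: compact_closed => //; apply: continuous_compact => //.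
  exact: continuous_subspaceT.
have cB : closed B.
  by apply: open_closedC; exact: one_point_compactification_open_some.
have AB : B `&` A = set0.
  by rewrite -subset0 => z [nU [x Kx xz]]; apply: nU; exists x => //; exact: KU.
have /(@uniform_separatorP _ R)[f [cf f01 fB fA]] :=
  (@normal_separatorP R opc).1 nO B A cB cA AB.
have fs : continuous (f \o Some : T -> R).
  by move=> x; apply: continuous_comp; [exact: someC|exact: cf].
pose g (x : T) : R := (2 * Num.max (f (Some x) - 2^-1) 0)%R.
have fN : f None = 0%R by apply: fB; exists None => //; case.
have f_itv x : (0 <= f x <= 1)%R by have := f01 (f x); rewrite /= in_itv; apply;
  exists x.
have gc : continuous g.
  move=> x; apply: cvgM; first exact: cvg_cst.
  apply: (@continuous_max _ _ (fun x => f (Some x) - 2^-1)%R (cst 0%R)).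
    by apply: cvgB; [exact: fs|exact: cvg_cst].
  exact: cvg_cst.
(* [f] vanishes at infinity, so it is below 1/2 off some closed compact [C], and there the
   truncation [g] is 0. *)
have [C [cptC clC] CP] : nbhs (None : opc) (f @^-1` [set y | y < 2^-1]%R).
  apply: (cf None [set y | y < 2^-1]%R); rewrite fN; apply: open_nbhs_nbhs.
  by split; [exact: open_lt|rewrite /= invr_gt0].
exists g; split.
- split=> //.
  apply: (@subclosed_compact _ _ C) => //; first exact: closed_closure.
  rewrite [X in _ `<=` X](iffLR (closure_id C) clC); apply: closureS => x /= gx.
  apply: contrapT => nCx.
  have /= lt2 := CP (Some x) (or_introl (ex_intro2 _ _ x nCx erefl)).
  move/eqP: gx; apply; rewrite /g max_r ?mulr0// subr_le0 ltW//.
- move=> x; rewrite /g; have /andP[f0 f1] := f_itv (Some x).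
  rewrite mulr_ge0//= ?le_max ?lexx ?orbT//.
  rewrite -ler_pdivlMl// mulr1 ge_max invr_ge0 ler0n andbT.
  by lra.
- move=> x Kx; rewrite /g.
  have -> : f (Some x) = 1%R by apply: fA; exists (Some x) => //; exists x.
  by rewrite max_l; lra.
- move=> x nUx; rewrite /g.
  have -> : f (Some x) = 0%R.
    by apply: fB; exists (Some x) => //; case=> y Uy [yx]; apply: nUx;
      rewrite -yx.
  by rewrite max_r ?mulr0// sub0r oppr_le0 invr_ge0.
Qed.

Section cc_fun_theory.
Context (R : realType) (T : topologicalType).
Implicit Types f g : T -> R.

Lemma compact_closure_support f (C : set T) : closed C -> compact C ->
  [set t | f t != 0%R] `<=` C -> compact (closure [set t | f t != 0%R]).
Proof.
move=> clC cC fC; apply: (@subclosed_compact _ _ C) => //.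
  exact: closed_closure.
by rewrite [X in _ `<=` X](iffLR (closure_id C) clC); exact: closureS.
Qed.

Lemma cc_funD f g : cc_fun f -> cc_fun g -> cc_fun (fun x => f x + g x)%R.
Proof.
move=> [cf sf] [cg sg]; split; first by move=> x; apply: cvgD;
  [exact: cf|exact: cg].
apply: (@compact_closure_support _
  (closure [set t | f t != 0%R] `|` closure [set t | g t != 0%R])).
- by apply: closedU; exact: closed_closure.
- exact: compactU.
- move=> x /= fgx; have [f0|f0] := eqVneq (f x) 0%R; [right|left];
    apply: subset_closure => //=.
  by move: fgx; rewrite f0 add0r.
Qed.

Lemma cc_funZ c f : cc_fun f -> cc_fun (fun x => c * f x)%R.
Proof.
move=> [cf sf]; split; first by move=> x; apply: cvgM;
  [exact: cvg_cst|exact: cf].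
apply: (@compact_closure_support _ (closure [set t | f t != 0%R])) => //.
  exact: closed_closure.
by move=> x /=; rewrite mulf_eq0 negb_or => /andP[_ ?]; apply: subset_closure.
Qed.

Lemma cc_fun0 : cc_fun (cst 0%R : T -> R).
Proof.
split; first exact: cst_continuous.
apply: (@compact_closure_support _ set0).
- exact: closed0.
- exact: compact0.
- by move=> x /=; rewrite eqxx.
Qed.

Lemma cc_fun_bounded f : cc_fun f -> exists M : R, forall x, (`|f x| <= M)%R.
Proof.
move=> [cf sf].
have /compact_bounded[M [_ MP]] : compact (f @` closure [set t | f t != 0%R]).
  apply: continuous_compact => //; exact: continuous_subspaceT.
(* Every number above [M] is a bound on the closed support, hence [M + 1]; the 0 covers the points
   off the support. *)
exists (Num.max (M + 1) 0)%R => x; have [->|fx0] := eqVneq (f x) 0%R.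
  by rewrite normr0 le_max lexx orbT.
rewrite le_max (MP (M + 1)%R) ?ltrDl//.
by exists x => //; exact: subset_closure.
Qed.

End cc_fun_theory.

(** Cozero sets are what Urysohn's lemma produces inside an open set. A generating family that
    contains them can stand in for the open sets on one factor of a product, as in
    [continuous_measurable_prod]. *)
Definition contains_cozero (R : realType) (T : topologicalType)
  (S : set_system T) :=
  forall f : T -> R, continuous f -> S [set x | 0 < f x]%R.

Lemma contains_cozero_open (R : realType) (T : topologicalType) :
  contains_cozero R (@open T).
Proof.
move=> f cf; rewrite (_ : mkset _ = f @^-1` [set y | 0 < y]%R)//.
by apply: open_comp.
Qed.

(** * Joint measurability of continuous functions on a product *)

Section borel.
Context (R : realType) (T : topologicalGroupType).
Hypothesis hT : locally_compact_group T.

Let hdT : hausdorff_space T. Proof. by case: hT. Qed.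
Let lcT : locally_compact [set: T]. Proof. by case: hT. Qed.

Lemma sigma_compact_ndseq : exists K : nat -> set T,
  [/\ forall k, compact (K k), \bigcup_k K k = setT & forall i j,
    (i <= j)%N -> K i `<=` K j].
Proof.
have [_ _ [K cK KT]] := hT.
exists (fun n => \bigcup_(i < n.+1) K i); split.
- by move=> k; rewrite bigcup_mkord; exact: bigsetU_compact.
- rewrite -subTset -KT => x [k _ Kx]; exists k => //; exists k => //=.
- by move=> i j ij; apply: bigcup_sub => k /= ki; apply: bigcup_sup;
    exact: leq_trans ki _.
Qed.

Lemma measurable_compact (K : set T) : compact K -> measurable (K :
  set (borel T)).
Proof.
move=> cK; rewrite -[K]setCK; apply: measurableC; apply: sub_gen_smallest.
by rewrite /= openC; exact: compact_closed.
Qed.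

(* [T * T] need not be second countable, but [F @^-1` `]c, +oo[] is a countable
   union of finite unions of open rectangles by compactness of the sets
   [F >= c + 1/q] intersected with compact rectangles. *)
Lemma continuous_measurable_prod (S : set_system T) (F : T * T -> R) :
  contains_cozero R S -> continuous F ->
  measurable_fun [set: borel T * g_sigma_algebraType S] F.
Proof.
move=> SO cF; apply: (measurability _ (RGenOInfty.measurableE R)).
move=> _ [_ [c ->] <-]; rewrite setTI.
have [K [cK KT Kmon]] := sigma_compact_ndseq.
(* Around each point of [[F > c]] lies an open rectangle inside that set whose second side is a
   cozero set, hence in [S]. The pair of empty sets is a dummy value at the other points, so that
   [choice] yields a total function. *)
have rect (z : T * T) : exists UV : set T * set T, (c < F z)%R ->
    [/\ open UV.1, S UV.2, UV.1 z.1 /\ (open UV.2 /\ UV.2 z.2) &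
        UV.1 `*` UV.2 `<=` [set z | c < F z]%R].
  have [cFz|ncFz] := pselect (c < F z)%R; last by exists (set0, set0) => /ncFz.
  have : nbhs z [set z | c < F z]%R.
    by apply: (cF z [set y | c < y]%R); apply: open_nbhs_nbhs; split;
      [exact: open_gt|].
  case: z cFz => a b cFab [[P Q] /= [Pa Qb] PQ].
  move: Pa Qb; rewrite !nbhsE => -[P' [oP' P'a] P'P] [Q' [oQ' Q'b] Q'Q].
  have bQ' : [set b] `<=` Q' by move=> _ ->.
  have [f [[fc _] _ f1 f0]] :=
    @exists_cc_fun R T _ _ hdT lcT (@compact_set1 _ b) oQ' bQ'.
  exists (P', [set x | 0 < f x]%R) => _; split => //=.
  - exact: SO.
  - by split=> //; split; [exact: contains_cozero_open|rewrite f1].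
  - move=> [x y] /= [P'x fy]; apply: (PQ (x, y)); split => /=; [exact: P'P|].
    by apply: Q'Q; apply: contrapT => /f0 fy0; rewrite fy0 ltxx in fy.
have {rect}[UV UVP] := choice rect.
have cover (q k : nat) : exists D : {fset (T * T)},
    {subset D <= [set z | c < F z]%R} /\
    [set z | c + q.+1%:R^-1 <= F z]%R `&` (K k `*` K k) `<=`
      \bigcup_(z in [set` D]) ((UV z).1 `*` (UV z).2).
  set A := _ `&` _.
  have cA : compact A.
    rewrite /A setIC; apply: compact_closedI; first exact: compact_setX.
    rewrite (_ : mkset _ = F @^-1` [set y | c + q.+1%:R^-1 <= y]%R)//.
    by apply: preimage_closed => //; exact: closed_ge.
  have AP z : A z -> (c < F z)%R.
    by move=> -[/= + _]; apply: lt_le_trans; rewrite ltrDl invr_gt0.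
  pose TT : ptopologicalType := HB.pack (T * T)%type
    (Topological.class (T * T)%type) (Pointed.class (T * T)%type).
  move: cA; rewrite (@compact_cover TT) => /(_ _ A (fun z =>
    (UV z).1 `*` (UV z).2)).
  case.
  - move=> z Az; have [opU _ [_ [opV _]] _] := UVP z (AP _ Az).
    rewrite openE => -[a b] [/= Ua Vb]; exists ((UV z).1, (UV z).2) => //=.
    by split; apply: open_nbhs_nbhs.
  - move=> z Az; exists z => //; have [_ _ [? [_ ?]] _] := UVP z (AP _ Az).
    by split.
  - move=> D DA DAc; exists D; split=> // z zD.
    by apply: mem_set; exact: AP (set_mem (DA _ zD)).
pose D q k := sval (cid (cover q k)).
have DP q k : {subset D q k <= [set z | c < F z]%R} /\
    [set z | c + q.+1%:R^-1 <= F z]%R `&` (K k `*` K k) `<=`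
      \bigcup_(z in [set` D q k]) ((UV z).1 `*` (UV z).2).
  exact: svalP (cid (cover q k)).
have -> : F @^-1` `]c, +oo[ = \bigcup_q \bigcup_k
    \bigcup_(z in [set` D q k]) ((UV z).1 `*` (UV z).2).
  apply/seteqP; split=> [[a b]|]; last first.
    move=> z [q _ [k _ [w wD zw]]].
    have wF := set_mem ((DP q k).1 _ wD).
    have [_ _ _ /(_ z zw)] := UVP _ wF.
    by rewrite /= in_itv /= andbT.
  rewrite /= in_itv /= andbT => cF'.
  have [q /ltW qP] : exists q : nat, (q.+1%:R^-1 < F (a, b) - c)%R.
    have F0 : (0 < F (a, b) - c)%R by rewrite subr_gt0.
    by have [q] := ltr_add_invr F0; rewrite add0r => qP; exists q.
  have [i _ Ki] : (\bigcup_k K k) a by rewrite KT.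
  have [j _ Kj] : (\bigcup_k K k) b by rewrite KT.
  exists q => //; exists (maxn i j) => //; apply: (DP q _).2; split => /=.
    by rewrite -lerBrDl.
  by split=> /=; [apply: Kmon Ki; exact: leq_maxl|apply: Kmon Kj;
    exact: leq_maxr].
apply: bigcupT_measurable => q; apply: bigcupT_measurable => k.
apply: fin_bigcup_measurable; first exact: finite_fset.
move=> z zD; have wF := set_mem ((DP q k).1 _ zD).
have [opU S2 _ _] := UVP _ wF.
by apply: measurableX; exact: sub_gen_smallest.
Qed.

End borel.

(** * Haar measures on closed subgroups *)

Section product_integral.
Context d1 d2 (T1 : measurableType d1) (T2 : measurableType d2) (R : realType).
Variables (m1 : {measure set T1 -> \bar R}) (m2 : {measure set T2 -> \bar R}).

(** Sigma-finiteness is a proved property of the measures considered here, while Tonelli's theorem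
    takes it bundled with the measure. The underlying measure is unchanged, so the integrals agree
    by conversion. *)
Definition sigma_finite_pack d (T : measurableType d)
    (m : {measure set T -> \bar R}) (sm : sigma_finite setT m) :
    {sigma_finite_measure set T -> \bar R} :=
  let sfin := @isSFinite.Build d T R m (sfinite_measure_sigma_finite sm) in
  let sigma := @isSigmaFinite.Build d T R m sm in
  HB.pack_for (SigmaFiniteMeasure.type T R) (Measure.sort m) sfin sigma.

Lemma measurable_integral2 (f : T1 * T2 -> \bar R) : sigma_finite setT m2 ->
  measurable_fun setT f -> (forall z, 0 <= f z) ->
  measurable_fun setT (fun x => \int[m2]_y f (x, y)).
Proof.
by move=> s2; exact: (@measurable_fun_fubini_tonelli_F _ _ _ _ _
  (sigma_finite_pack s2)).
Qed.

Lemma measurable_integral1 (f : T1 * T2 -> \bar R) : sigma_finite setT m1 ->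
  measurable_fun setT f -> (forall z, 0 <= f z) ->
  measurable_fun setT (fun y => \int[m1]_x f (x, y)).
Proof.
by move=> s1; exact: (@measurable_fun_fubini_tonelli_G _ _ _ _ _
  (sigma_finite_pack s1)).
Qed.

Lemma tonelli (f : T1 * T2 -> \bar R) :
  sigma_finite setT m1 -> sigma_finite setT m2 ->
  measurable_fun setT f -> (forall z, 0 <= f z) ->
  \int[m1]_x \int[m2]_y f (x, y) = \int[m2]_y \int[m1]_x f (x, y).
Proof.
move=> s1 s2.
exact: (@fubini_tonelli _ _ _ _ _ (sigma_finite_pack s1) (sigma_finite_pack
  s2)).
Qed.

End product_integral.

(** The hypothesis says that the push-forward of [m] by [phi] is the measure [k m]; both sides are
    the integral of [F] against it. *)
Lemma integral_relatively_invariant d (T : measurableType d) (R : realType)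
    (m : {measure set T -> \bar R}) (phi : T -> T) (k : R) (F : T -> \bar R) :
  measurable_fun setT phi -> (0 <= k)%R ->
  (forall A, measurable A -> m (phi @^-1` A) = k%:E * m A) ->
  measurable_fun setT F -> (forall x, 0 <= F x) ->
  \int[m]_x F (phi x) = k%:E * \int[m]_x F x.
Proof.
move=> mphi k0 mk mF F0.
have F0' : {in setT, forall y, 0 <= F y} by move=> y _; exact: F0.
rewrite -(@ge0_integral_mscale _ _ _ _ _ measurableT (NngNum k0))//.
have /= := ge0_integral_pushforward mphi m measurableT mF F0'.
rewrite preimage_setT => <-.
by apply: eq_measure_integral => A mA _; exact: mk.
Qed.

Lemma ae_imply d (T : measurableType d) (R : realType)
    (m : {measure set T -> \bar R}) (P Q : T -> Prop) :
  (forall x, P x -> Q x) -> {ae m, forall x, P x} -> {ae m, forall x, Q x}.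
Proof. by move=> PQ; apply: (@filterS _ _ (ae_filter_ringOfSetsType m)). Qed.

Lemma ae_imply2 d (T : measurableType d) (R : realType)
    (m : {measure set T -> \bar R}) (P1 P2 Q : T -> Prop) :
  (forall x, P1 x -> P2 x -> Q x) -> {ae m, forall x, P1 x} ->
  {ae m, forall x, P2 x} -> {ae m, forall x, Q x}.
Proof. by move=> PQ; apply: (@filterS2 _ _ (ae_filter_ringOfSetsType m)). Qed.

(** * Radon measures, Haar measures and the modular function *)

Section haar.
Context (R : realType) (G : topologicalGroupType).
Hypothesis hG : locally_compact_group G.
Implicit Types (H : set G) (m : {measure set (borel G) -> \bar R}).

Let hdG : hausdorff_space G. Proof. by case: hG. Qed.
Let lcG : locally_compact [set: G]. Proof. by case: hG. Qed.

Lemma measurable_open (U : set G) : open U -> measurable (U : set (borel G)).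
Proof. exact: sub_gen_smallest. Qed.

Lemma measurable_closed (C : set G) : closed C -> measurable (C :
  set (borel G)).
Proof.
move=> cC; rewrite -[C]setCK; apply: measurableC; apply: measurable_open.
by rewrite openC.
Qed.

Lemma continuous_measurable_borel (f : G -> G) : continuous f ->
  measurable_fun [set: borel G] (f : borel G -> borel G).
Proof.
move=> cf; apply: (measurability _ (erefl (measurable : set_system (borel G)))).
move=> _ [U oU <-]; rewrite setTI; apply: measurable_open.
by apply: open_comp.
Qed.

Lemma continuous_measurable_real (f : G -> R) : continuous f ->
  measurable_fun [set: borel G] (f : borel G -> R).
Proof.
move=> cf; apply: (measurability _ (RGenOInfty.measurableE R)).
move=> _ [_ [c ->] <-]; rewrite setTI; apply: measurable_open.
by apply: open_comp => //; exact: interval_open.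
Qed.

Lemma invg_cont : continuous (fun x : G => x^-1%g).
Proof. exact: invg_continuous. Qed.

Lemma mulgr_cont (s : G) : continuous (fun t : G => (t * s)%g).
Proof.
move=> t; apply: (@continuous_comp _ _ _ (fun t : G => (t, s))
  (fun z : G * G => (z.1 * z.2)%g)); last exact: mulg_continuous.
by apply: cvg_pair; [exact: cvg_id|exact: cvg_cst].
Qed.

Lemma mulgl_cont (s : G) : continuous (fun t : G => (s * t)%g).
Proof.
move=> t; apply: (@continuous_comp _ _ _ (fun t : G => (s, t))
  (fun z : G * G => (z.1 * z.2)%g)); last exact: mulg_continuous.
by apply: cvg_pair; [exact: cvg_cst|exact: cvg_id].
Qed.

Lemma radon_sigma_finite H m : radon_measure_on H m -> sigma_finite setT m.
Proof.
move=> hm; have [K [cK KT _]] := sigma_compact_ndseq hG.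
exists K; first by rewrite KT.
move=> i; split; first exact: measurable_compact.
exact: radon_compact hm _ (cK i).
Qed.

Lemma radon_ae H m : closed H -> radon_measure_on H m -> {ae m, forall t, H t}.
Proof.
move=> cH hm; exists (~` H); split => //.
- by apply: measurableC; exact: measurable_closed.
- exact: radon_supported hm.
Qed.

Lemma radon_setT H m : closed H -> radon_measure_on H m -> m setT = m H.
Proof.
move=> cH hm; rewrite -(setUv H) measureU//.
- by rewrite [X in _ + X](radon_supported hm) adde0.
- exact: measurable_closed.
- by apply: measurableC; exact: measurable_closed.
- exact: setICr.
Qed.

(** The whole group is open and has positive measure, so inner regularity provides a compact set of
    positive measure. *)
Lemma radon_compact_pos H m : closed H -> radon_measure_on H m ->
  exists2 K, compact K & 0 < m K < +oo.
Proof.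
move=> cH hm.
have mT : 0 < m setT.
  by rewrite lt0e (radon_setT cH hm) (radon_neq0 hm) measure_ge0.
move: mT; rewrite (radon_inner hm openT) => /ereal_sup_gt[_ [K [cK _] <-] K0].
by exists K => //; rewrite K0 (radon_compact hm).
Qed.

Lemma cc_fun_integrable H m (f : G -> R) : radon_measure_on H m -> cc_fun f ->
  m.-integrable setT (EFin \o f).
Proof.
move=> hm cf; have [M fM] := cc_fun_bounded cf; have [f_cont f_supp] := cf.
set K := closure _ in f_supp.
have mK : measurable (K : set (borel G)) by exact: measurable_compact.
have M0 : (0 <= M)%R by exact: le_trans (normr_ge0 _) (fM 1%g).
have mf : measurable_fun [set: borel G] (f : borel G -> R).
  exact: continuous_measurable_real.
have mI : measurable_fun [set: borel G] (\1_(K : set (borel G)) : borel G -> R).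
  exact: measurable_indic.
apply/integrableP; split; first exact/measurable_EFinP.
apply: (@le_lt_trans _ _ (\int[m]_x (M%:E * (\1_(K : set (borel G)) x)%:E))).
  apply: ge0_le_integral => //.
  - by apply: measurableT_comp => //; exact/measurable_EFinP.
  - by apply: measurable_funeM; exact/measurable_EFinP.
  - move=> x _ /=; rewrite -EFinM lee_fin indicE.
    have [Kx|nKx] := boolP (x \in K); first by rewrite mulr1.
    suff -> : f x = 0%R by rewrite normr0 mulr0.
    apply: contrapT => /eqP fx0; move/negP: nKx; apply; apply: mem_set.
    exact: subset_closure.
rewrite ge0_integralZl_EFin//; last exact/measurable_EFinP.
rewrite integral_indic// setIT lte_mul_pinfty// ?lee_fin//.
exact: radon_compact hm _ f_supp.
Qed.

(** Take a Urysohn function equal to 1 on a compact set of positive measure. It serves as a test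
    function by whose integral one can divide. *)
Lemma radon_cc_pos H m : closed H -> radon_measure_on H m ->
  exists f : G -> R, [/\ cc_fun f, forall x, (0 <= f x)%R,
     0 < \int[m]_x (f x)%:E & \int[m]_x (f x)%:E < +oo].
Proof.
move=> cH hm; have [K cK /andP[K0 Koo]] := radon_compact_pos cH hm.
have [f [cf f01 fK _]] := exists_cc_fun R hdG lcG cK openT (@subsetT _ K).
have f0 x : (0 <= f x)%R by case/andP: (f01 x).
exists f; split => //.
- rewrite (lt_le_trans K0)//.
  rewrite -(setIT K) -integral_indic//; last exact: measurable_compact.
  apply: ge0_le_integral => //.
  + by apply/measurable_EFinP; apply: measurable_indic;
      exact: measurable_compact.
  + by apply/measurable_EFinP; apply: continuous_measurable_real; case: cf.
  + move=> x _; rewrite lee_fin indicE; have [Kx|_] := boolP (x \in K) => //.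
    by rewrite (fK x (set_mem Kx)) lexx.
- have /integrableP[_] := cc_fun_integrable hm cf.
  by under eq_integral do rewrite /= ger0_norm//.
Qed.

Lemma group_closedT : group_closed [in [set: G]].
Proof. by split=> [|x y _ _]; exact: mem_set. Qed.

Lemma closed_subgroupT : closed_subgroup [set: G].
Proof. by split; [exact: closedT|exact: group_closedT]. Qed.

Section subgroup.
Context (H : set G) (m : {measure set (borel G) -> \bar R}).
Hypotheses (clH : closed_subgroup H) (hm : right_haar_measure H m).

Let closedH : closed H. Proof. by case: clH. Qed.
Let radonH : radon_measure_on H m. Proof. by case: hm. Qed.

Lemma subgroupV s : H s -> H s^-1%g.
Proof.
by case: clH => _ /group_closedV Hv Hs; have /set_mem := Hv s (mem_set Hs).
Qed.

Lemma subgroupVE s : H s^-1%g = H s.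
Proof.
by apply/propext; split; [move/subgroupV; rewrite invgK|exact: subgroupV].
Qed.

Lemma right_haar_preimage (s : G) (A : set (borel G)) : H s -> measurable A ->
  m [set t : G | A (t * s)%g] = m A.
Proof.
move=> Hs mA; rewrite -(hm.2 s^-1%g A (subgroupV Hs) mA); congr (m _).
apply/seteqP; split=> [t /= At|_ [t At <-]] /=; last by rewrite mulgVK.
by exists (t * s)%g => //; rewrite mulgK.
Qed.

Lemma right_haar_integral (s : G) (F : G -> \bar R) : H s ->
  measurable_fun [set: borel G] F -> (forall t, 0 <= F t) ->
  \int[m]_t F (t * s)%g = \int[m]_t F t.
Proof.
move=> Hs mF F0; rewrite -[RHS]mul1e.
apply: (@integral_relatively_invariant _ (borel G) R m (fun t :
  G => (t * s)%g)) => //.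
- by apply: continuous_measurable_borel; exact: mulgr_cont.
- by move=> A mA; rewrite mul1e right_haar_preimage.
Qed.

Let measurable_invg : measurable_fun [set: borel G] ((fun x : G => x^-1%g) :
  borel G -> borel G).
Proof. by apply: continuous_measurable_borel; exact: invg_cont. Qed.

(** [modular_function] speaks of left Haar measures. The image of [m] under inversion is one,
    because inversion is a homeomorphism that preserves [H] and exchanges left and right
    translations; this brings the modular function to bear on [m]. *)
Let inv_measure : {measure set (borel G) -> \bar R}.
Proof.
refine [the {measure set (borel G) -> \bar R} of
  pushforward m ((fun x : G => x^-1%g) : borel G -> borel G)].
exact: measurable_invg.
Defined.

Let inv_measureE (A : set G) : inv_measure A = m [set x : G | A x^-1%g].
Proof. by []. Qed.

Let preimage_invgK (A : set G) : [set x : G | A x^-1^-1]%g = A.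
Proof. by apply/seteqP; split=> x /=; rewrite invgK. Qed.

Let open_preimage_invg (U : set G) : open U -> open [set x : G | U x^-1%g].
Proof. by move=> oU; apply: open_comp => // x _; exact: invg_cont. Qed.

Let compact_preimage_invg (K : set G) : compact K -> compact [set x :
  G | K x^-1%g].
Proof.
move=> cK; rewrite (_ : mkset _ = (fun x : G => x^-1%g) @` K).
  by apply: continuous_compact => //; apply: continuous_subspaceT;
    exact: invg_cont.
apply/seteqP; split=> [x Kx|_ [y Ky <-]] /=; last by rewrite invgK.
by exists x^-1%g => //; rewrite invgK.
Qed.

Let inv_left_haar : left_haar_measure H inv_measure.
Proof.
split; first split.
- rewrite inv_measureE -(radon_supported radonH); congr (m _).
  by apply/seteqP; split=> x /=; rewrite subgroupVE.
- rewrite inv_measureE (_ : [set x | H x^-1%g] = H) ?(radon_neq0 radonH)//.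
  by apply/seteqP; split=> x /=; rewrite subgroupVE.
- by move=> K cK; apply: (radon_compact radonH); exact: compact_preimage_invg.
- move=> A mA; rewrite inv_measureE (radon_outer radonH); last first.
    by rewrite -[X in measurable X]setTI; exact: measurable_invg.
  congr ereal_inf; apply/seteqP; split=> _ [U [oU AU] <-].
    exists [set x : G | U x^-1%g]; last by rewrite inv_measureE preimage_invgK.
    by split=> [|x Ax]; [exact: open_preimage_invg|apply: AU; rewrite /= invgK].
  exists [set x : G | U x^-1%g] => //.
  by split=> [|x Ax]; [exact: open_preimage_invg|exact: AU].
- move=> U oU; rewrite inv_measureE (radon_inner radonH); last first.
    exact: open_preimage_invg.
  congr ereal_sup; apply/seteqP; split=> _ [K [cK KU] <-].
    exists [set x : G | K x^-1%g]; last by rewrite inv_measureE preimage_invgK.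
    by split=> [|x /KU /=]; [exact: compact_preimage_invg|rewrite invgK].
  exists [set x : G | K x^-1%g] => //.
  by split=> [|x Kx]; [exact: compact_preimage_invg|exact: KU].
- move=> s A Hs mA; rewrite !inv_measureE.
  rewrite -[RHS](right_haar_preimage Hs); last first.
    by rewrite -[X in measurable X]setTI; exact: measurable_invg.
  congr (m _); apply/seteqP; split=> [x [y Ay sy]|x /= Ax].
    by rewrite /= invgM -sy mulKg.
  by exists ((x * s)^-1)%g => //; rewrite invgM mulVKg.
Qed.

Variable D : G -> R.
Hypothesis hD : modular_function H D.

(** Inversion carries {t : st in A} = s^-1 A to A^-1 s, so this is the modular identity of
    [inv_measure] at the set A^-1. *)
Lemma right_haar_preimagel (s : G) (A : set (borel G)) : H s -> measurable A ->
  m [set t : G | A (s * t)%g] = (D s)%:E * m A.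
Proof.
move=> Hs mA.
have mVA : measurable ([set x : G | A x^-1%g] : set (borel G)).
  by rewrite -[X in measurable X]setTI; exact: measurable_invg.
have := hD inv_left_haar Hs mVA; rewrite !inv_measureE preimage_invgK => <-.
congr (m _); apply/seteqP; split=> [x /= Ax|x [y Ay /(congr1 (fun z =>
  z^-1)%g)]].
  by exists (s * x)^-1%g; rewrite ?invgK// invgM mulgVK.
by rewrite /= invgK invgM => <-; rewrite mulVKg.
Qed.

(** Left translation multiplies a positive finite measure by [D s], and the result is still the
    measure of a set. *)
Lemma modular_ge0 s : H s -> (0 <= D s)%R.
Proof.
move=> Hs; have [K cK /andP[K0 Koo]] := radon_compact_pos closedH radonH.
have mK : measurable (K : set (borel G)) by exact: measurable_compact.
have : 0 <= m [set t : G | K (s * t)%g] by exact: measure_ge0.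
by rewrite (right_haar_preimagel Hs mK) pmule_lge0// lee_fin.
Qed.

Lemma right_haar_integrall (s : G) (F : G -> \bar R) : H s ->
  measurable_fun [set: borel G] F -> (forall t, 0 <= F t) ->
  \int[m]_t F (s * t)%g = (D s)%:E * \int[m]_t F t.
Proof.
move=> Hs mF F0.
apply: (@integral_relatively_invariant _ (borel G) R m (fun t :
  G => (s * t)%g)) => //.
- by apply: continuous_measurable_borel; exact: mulgl_cont.
- exact: modular_ge0.
- by move=> A mA; exact: right_haar_preimagel.
Qed.

End subgroup.
End haar.

(** * The inversion formula for Haar measures *)

Section inversion.
Context (R : realType) (G : topologicalGroupType).
Hypothesis hG : locally_compact_group G.
Context (H : set G) (m : {measure set (borel G) -> \bar R}).
Hypotheses (clH : closed_subgroup H) (hm : right_haar_measure H m).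

(** [m] lives on all of [G] but is carried by [H]. Under the integral sign, invariance under
    translation by [t] may therefore be used as if every [t] were in [H]. *)
Lemma eq_integral_subgroup (f g : G -> \bar R) :
  measurable_fun [set: borel G] f -> measurable_fun [set: borel G] g ->
  (forall t, 0 <= f t) -> (forall t, 0 <= g t) ->
  (forall t, H t -> f t = g t) -> \int[m]_t f t = \int[m]_t g t.
Proof.
move=> mf mg f0 g0 fg; apply: ge0_ae_eq_integral => //.
by apply: ae_imply (radon_ae clH.1 hm.1) => t Ht _; exact: fg.
Qed.

Let sfm : sigma_finite setT m. Proof. exact: radon_sigma_finite hm.1. Qed.

Lemma measurable_mul_translate (b : G -> \bar R) :
  measurable_fun [set: borel G * borel G] (fun z : G * G => b (z.1 * z.2)%g) ->
  measurable_fun [set: borel G] b.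
Proof.
move=> /(measurable_fun_pair1 ((1%g : G) : borel G)).
by apply: eq_measurable_fun => t _ /=; rewrite mulg1.
Qed.

Let measurable_mulp (a : G -> R) : continuous a ->
  measurable_fun [set: borel G * borel G] (fun z :
    G * G => (a (z.1 * z.2)%g)%:E).
Proof.
move=> ca; apply/measurable_EFinP.
apply: (continuous_measurable_prod hG (@contains_cozero_open R G)) => z.
by apply: continuous_comp; [exact: mulg_continuous|exact: ca].
Qed.

Variable D : G -> R.
Hypothesis hD : modular_function H D.

(** [D s] is the quotient of the integrals of a(st) and of a(t) in [t], for a fixed [a] in C_c(G);
    the numerator is measurable in [s] by Tonelli's theorem. *)
Lemma measurable_modular : H = setT -> measurable_fun [set: borel G] D.
Proof.
move=> HT; have [a [ccf a0 Ia0 Iaoo]] := radon_cc_pos hG clH.1 hm.1.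
have ma : measurable_fun [set: borel G] (fun t : G => (a t)%:E).
  by apply/measurable_EFinP; apply: continuous_measurable_real; case: ccf.
have Ia : \int[m]_t (a t)%:E \is a fin_num by rewrite ge0_fin_numE// ltW.
have DE s : D s = (fine (\int[m]_t (a (s * t)%g)%:E) / fine (\int[m]_t (a
  t)%:E))%R.
  rewrite (right_haar_integrall hG clH hm hD (F := fun t => (a t)%:E))//.
  - by rewrite fineM// mulfK// gt_eqF// fine_gt0// Ia0.
  - by rewrite HT.
rewrite (funext DE); apply: measurable_funM => //.
apply: (measurableT_comp (fine_measurable measurableT)).
apply: (measurable_integral2 (f := fun z :
  borel G * borel G => (a (z.1 * z.2)%g)%:E)) => //.
- by apply: measurable_mulp; case: ccf.
- by move=> z; rewrite lee_fin.
Qed.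

Hypotheses (D0 : forall s, (0 <= D s)%R) (mD : measurable_fun [set: borel G] D).

(* Both sides are computed from [\int a(s) b(t s^-1) dm(t) dm(s)] for one fixed
   [a] in [C_c(G)] with positive integral, integrating first in [t] or first in
   [s]; uniqueness of Haar measures is not involved. *)
Lemma haar_inversion (b : G -> \bar R) :
  measurable_fun [set: borel G * borel G] (fun z : G * G => b (z.1 * z.2)%g) ->
  (forall t, 0 <= b t) ->
  \int[m]_s ((D s)%:E * b s^-1%g) = \int[m]_t b t.
Proof.
move=> mb2 b0; have mb := measurable_mul_translate mb2.
have [a [ccf a0 Ia0 Iaoo]] := radon_cc_pos hG clH.1 hm.1.
have ma : measurable_fun [set: borel G] (fun t : G => (a t)%:E).
  by apply/measurable_EFinP; apply: continuous_measurable_real; case: ccf.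
have Ia : \int[m]_t (a t)%:E \is a fin_num by rewrite ge0_fin_numE// ltW.
have minv : measurable_fun [set: borel G] ((fun x : G => x^-1%g) :
  borel G -> borel G).
  by apply: continuous_measurable_borel; exact: invg_cont.
have mbV : measurable_fun [set: borel G] (fun s : G => b s^-1%g).
  exact: (measurableT_comp mb).
have aE0 t : 0 <= (a t)%:E by rewrite lee_fin.
have mab : measurable_fun [set: borel G * borel G]
    (fun z : G * G => (a z.1)%:E * b (z.2 * z.1^-1)%g).
  apply: emeasurable_funM; first exact: (measurableT_comp ma measurable_fst).
  apply: (measurableT_comp (f := fun z : borel G * borel G => b ((z.1 :
    G) * z.2)%g)
    (g := fun z : borel G * borel G => (z.2, (z.1 : G)^-1%g) :
      borel G * borel G)) => //.
  apply: measurable_fun_pair => //.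
  exact: (measurableT_comp minv measurable_fst).
have mba : measurable_fun [set: borel G * borel G]
    (fun z : G * G => (a (z.2 * z.1)%g)%:E * b z.2^-1%g).
  apply: emeasurable_funM.
    apply: (measurableT_comp (f := fun z : borel G * borel G => (a ((z.1 :
      G) * z.2)%g)%:E)
      (g := fun z : borel G * borel G => (z.2, z.1) : borel G * borel G)).
      by apply: measurable_mulp; case: ccf.
    exact: measurable_fun_pair.
  exact: (measurableT_comp mbV measurable_snd).
have ab0 (z : G * G) : 0 <= (a z.1)%:E * b (z.2 * z.1^-1)%g by rewrite mule_ge0.
have ba0 (z : G * G) : 0 <= (a (z.2 * z.1)%g)%:E * b z.2^-1%g by rewrite
  mule_ge0.
have mDE : measurable_fun [set: borel G] (fun s =>
  (D s)%:E) by exact/measurable_EFinP.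
have DE0 s : 0 <= (D s)%:E by rewrite lee_fin.
have DbV0 s : 0 <= (D s)%:E * b s^-1%g by rewrite mule_ge0.
have mDbV : measurable_fun [set: borel G] (fun s : G => (D s)%:E * b s^-1%g).
  exact: emeasurable_funM.
have Ib0 : 0 <= \int[m]_t b t by exact: integral_ge0.
(* With [t] integrated first, right translation by s^-1 removes [s] from [b], and the double
   integral splits into a product. *)
have : \int[m]_s \int[m]_t ((a s)%:E * b (t * s^-1)%g) =
    \int[m]_t (a t)%:E * \int[m]_t b t.
  rewrite -ge0_integralZr//; apply: eq_integral_subgroup.
  - exact: (measurable_integral2 sfm mab ab0).
  - exact: emeasurable_funM.
  - by move=> s; apply: integral_ge0 => t _; exact: (ab0 (s, t)).
  - by move=> s; rewrite mule_ge0.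
  - move=> s Hs; rewrite ge0_integralZl//; last first.
      apply: (measurableT_comp mb); apply: continuous_measurable_borel.
      exact: mulgr_cont.
    by congr (_ * _); apply: (right_haar_integral clH hm) => //;
      exact: subgroupV.
rewrite (tonelli sfm sfm mab ab0) /=.
(* For fixed [t] in [H], right invariance allows [s] to be replaced by [s * t], which turns t s^-1
   into s^-1. *)
have -> : \int[m]_t \int[m]_s ((a s)%:E * b (t * s^-1)%g) =
    \int[m]_t \int[m]_s ((a (s * t)%g)%:E * b s^-1%g).
  apply: eq_integral_subgroup.
  - exact: (measurable_integral1 sfm mab ab0).
  - exact: (measurable_integral2 sfm mba ba0).
  - by move=> t; apply: integral_ge0 => s _; exact: (ab0 (s, t)).
  - by move=> t; apply: integral_ge0 => s _; exact: (ba0 (t, s)).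
  - move=> t Ht.
    have mabt : measurable_fun [set: borel G] (fun s :
      G => (a s)%:E * b (t * s^-1)%g).
      exact: (measurable_fun_pair1 (t : borel G) mab).
    rewrite -(right_haar_integral clH hm (F :=
      fun s => (a s)%:E * b (t * s^-1)%g) Ht)//.
      by apply: eq_integral => s _; rewrite invgM mulVKg.
    by move=> s; exact: (ab0 (s, t)).
rewrite (tonelli sfm sfm mba ba0) /=.
(* The left translation by [s] inside [a] produces the factor [D s]. *)
have -> : \int[m]_s \int[m]_t ((a (s * t)%g)%:E * b s^-1%g) =
    \int[m]_s ((D s)%:E * b s^-1%g * \int[m]_t (a t)%:E).
  apply: eq_integral_subgroup.
  - exact: (measurable_integral1 sfm mba ba0).
  - exact: emeasurable_funM.
  - by move=> s; apply: integral_ge0 => t _; exact: (ba0 (t, s)).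
  - by move=> s; rewrite mule_ge0// ltW.
  - move=> s Hs; rewrite ge0_integralZr//; last first.
      by apply: (measurableT_comp ma); apply: continuous_measurable_borel;
        exact: mulgl_cont.
    rewrite (right_haar_integrall hG clH hm hD (F := fun t => (a t)%:E))//.
    by rewrite muleAC.
rewrite ge0_integralZr//; last exact: ltW.
rewrite [LHS]muleC => abE; apply/eqP; rewrite eq_le.
by apply/andP; split; rewrite -(lee_pmul2l Ia Ia0) abE lexx.
Qed.

End inversion.

(** * Orbit integrals and the maximal inequality *)

(** This is the average Phi_n when [rho] is a Haar measure of G_n; the integral runs over all of [G]
    because such a measure is carried by G_n. The space [Y] will be both the given space and [G]
    under left translation. *)
Definition orbit_integral (R : realType) (G : topologicalGroupType)
    (Y : Type) (act : G -> Y -> Y) (rho : set (borel G) -> \bar R)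
    (f : Y -> \bar R) (y : Y) : \bar R :=
  \int[rho]_t f (act t y).

Section gspace.
Context (R : realType) (G : topologicalGroupType).
Hypothesis hG : locally_compact_group G.
Context dY (Y : measurableType dY) (m : {measure set Y -> \bar R}).
Context (act : G -> Y -> Y) (Delta : G -> R).
Hypothesis sfm : sigma_finite setT m.
Hypothesis mact : measurable_fun [set: borel G * Y]
  (fun z : borel G * Y => act z.1 z.2).
Hypothesis actM : forall s t y, act (s * t)%g y = act s (act t y).
Hypothesis act1 : forall y, act 1%g y = y.
Hypothesis mrel : forall s (A : set Y), measurable A ->
  m (act s @^-1` A) = (Delta s)%:E * m A.
Hypothesis Delta0 : forall s, (0 <= Delta s)%R.
Hypothesis mDelta : measurable_fun [set: borel G] Delta.

Lemma measurable_act (s : G) : measurable_fun setT (act s).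
Proof. exact: (measurable_fun_pair2 (s : borel G) mact). Qed.

Lemma measurable_orbit (y : Y) :
  measurable_fun [set: borel G] (fun t : G => act t y).
Proof. exact: (measurable_fun_pair1 y mact). Qed.

Let measurable_invg : measurable_fun [set: borel G]
  ((fun x : G => x^-1%g) : borel G -> borel G).
Proof. by apply: continuous_measurable_borel; exact: invg_cont. Qed.

(** The map (s, t) -> s(ty) factors through the action on [Y], which is jointly measurable, instead
    of through multiplication in [G]. This supplies the joint measurability required by
    [haar_inversion]. *)
Lemma measurable_orbit_mul (g : Y -> \bar R) (y : Y) : measurable_fun setT g ->
  measurable_fun [set: borel G * borel G]
    (fun z : G * G => g (act (z.1 * z.2)%g y)).
Proof.
move=> mg; under eq_fun do rewrite actM.
apply: (measurableT_comp mg).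
apply: (measurableT_comp (f := fun z : borel G * Y => act z.1 z.2)
  (g := fun z : borel G * borel G => (z.1, act z.2 y) : borel G * Y)) => //.
apply: measurable_fun_pair => //.
by apply: (measurableT_comp (measurable_orbit y)).
Qed.

Section one_subgroup.
Context (H : set G) (rho : {measure set (borel G) -> \bar R}).
Hypotheses (clH : closed_subgroup H) (hrho : right_haar_measure H rho).

Let sfrho : sigma_finite setT rho.
Proof. exact: radon_sigma_finite hG H rho hrho.1. Qed.

Local Notation Phi := (orbit_integral act rho).

Lemma measurable_orbit_integral f : measurable_fun setT f ->
  (forall y, 0 <= f y) -> measurable_fun setT (Phi f).
Proof.
move=> mf f0.
apply: (measurable_integral1 (f := fun z :
  borel G * Y => f (act z.1 z.2))) => //.
exact: (measurableT_comp mf mact).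
Qed.

Lemma orbit_integral_ge0 f y : (forall y, 0 <= f y) -> 0 <= Phi f y.
Proof. by move=> f0; apply: integral_ge0. Qed.

Lemma orbit_integral_invariant f s y : measurable_fun setT f ->
  (forall y, 0 <= f y) -> H s -> Phi f (act s y) = Phi f y.
Proof.
move=> mf f0 Hs; rewrite /orbit_integral.
under eq_integral do rewrite -actM.
apply: (right_haar_integral clH hrho (F := fun t => f (act t y))) => //.
exact: (measurableT_comp mf (measurable_orbit y)).
Qed.

Hypothesis hD : modular_function H Delta.

(** After Tonelli's theorem, the substitution y -> t^-1 y for fixed [t] moves the action from [f] to
    [g] at the cost of a factor Delta(t). The change t -> t^-1 then absorbs this factor, because
    [Delta] is also the modular function of [H]. *)
Lemma orbit_integral_adjoint f g :
  measurable_fun setT f -> measurable_fun setT g ->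
  (forall y, 0 <= f y) -> (forall y, 0 <= g y) ->
  \int[m]_y (g y * Phi f y) = \int[m]_y (f y * Phi g y).
Proof.
move=> mf mg f0 g0.
pose F1 (z : borel G * Y) := g z.2 * f (act z.1 z.2).
pose F2 (z : borel G * Y) := (Delta z.1)%:E * (g (act (z.1 :
  G)^-1%g z.2) * f z.2).
have mgV : measurable_fun [set: borel G * Y]
    (fun z : borel G * Y => g (act (z.1 : G)^-1%g z.2)).
  apply: (measurableT_comp mg).
  apply: (measurableT_comp (f := fun z : borel G * Y => act z.1 z.2)
    (g := fun z : borel G * Y => ((z.1 : G)^-1%g, z.2) : borel G * Y)) => //.
  apply: measurable_fun_pair => //.
  exact: (measurableT_comp measurable_invg measurable_fst).
have mF1 : measurable_fun setT F1.
  apply: emeasurable_funM; first exact: (measurableT_comp mg measurable_snd).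
  exact: (measurableT_comp mf mact).
have mDE : measurable_fun [set: borel G] (fun t => (Delta t)%:E).
  exact/measurable_EFinP.
have mF2 : measurable_fun setT F2.
  apply: emeasurable_funM; first exact: (measurableT_comp mDE measurable_fst).
  apply: emeasurable_funM => //; exact: (measurableT_comp mf measurable_snd).
have DE0 t : 0 <= (Delta t)%:E by rewrite lee_fin.
have F10 z : 0 <= F1 z by rewrite mule_ge0.
have F20 z : 0 <= F2 z by rewrite !mule_ge0.
transitivity (\int[m]_y \int[rho]_t F1 (t, y)).
  apply: eq_integral => y _; rewrite /orbit_integral /F1/= ge0_integralZl//.
  exact: (measurableT_comp mf (measurable_orbit y)).
rewrite -(tonelli sfrho sfm mF1 F10).
transitivity (\int[rho]_t \int[m]_y F2 (t, y)).
  apply: eq_integral => t _; rewrite /F1 /F2/=.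
  have mgf : measurable_fun setT (fun y => g (act t^-1%g y) * f y).
    by apply: emeasurable_funM => //; apply: (measurableT_comp mg);
      exact: measurable_act.
  have gf0 y : 0 <= g (act t^-1%g y) * f y by rewrite mule_ge0.
  rewrite ge0_integralZl//.
  rewrite -(integral_relatively_invariant (measurable_act t) (Delta0 t) (mrel t)
    mgf gf0).
  by apply: eq_integral => y _; rewrite -actM mulVg act1.
rewrite (tonelli sfrho sfm mF2 F20).
apply: eq_integral => y _; rewrite /F2/=.
have mgVy : measurable_fun [set: borel G] (fun t : G => g (act t^-1%g y)).
  exact: (measurable_fun_pair1 y mgV).
under eq_integral do rewrite muleA muleC.
rewrite ge0_integralZl//; last first.
- by move=> t _; rewrite mule_ge0.
- exact: emeasurable_funM.
congr (_ * _); rewrite /orbit_integral.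
rewrite (haar_inversion hG clH hrho hD Delta0 mDelta (b :=
  fun t => g (act t y)))//.
exact: measurable_orbit_mul.
Qed.

(** The indicator of an [H]-invariant set is constant along [H]-orbits, hence comes out of the
    integral. *)
Lemma orbit_integral_indicM (A : set Y) f y : measurable_fun setT f ->
  (forall y, 0 <= f y) ->
  measurable A -> (forall s y, H s -> A (act s y) = A y) ->
  Phi (fun z => f z * (\1_A z)%:E) y = Phi f y * (\1_A y)%:E.
Proof.
move=> mf f0 mA invA; rewrite /orbit_integral.
have mIA : measurable_fun setT (fun z => (\1_A z)%:E : \bar R).
  by apply/measurable_EFinP; exact: measurable_indic.
have mfy : measurable_fun [set: borel G] (fun t : G => f (act t y)).
  exact: (measurableT_comp mf (measurable_orbit y)).
rewrite -ge0_integralZr//.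
apply: (eq_integral_subgroup clH hrho).
- apply: emeasurable_funM => //; exact: (measurableT_comp mIA (measurable_orbit
    y)).
- exact: emeasurable_funM.
- by move=> t; rewrite mule_ge0.
- by move=> t; rewrite mule_ge0.
- move=> t Ht; congr (_ * ((nat_of_bool _)%:R)%:E).
  by apply/idP/idP => /set_mem Az; apply/mem_set;
    [rewrite -(invA t)|rewrite invA].
Qed.

(* Adjointness is applied to the function 1, for which [Phi 1] is a positive
   constant. *)
Lemma indic_orbit_integral_eq0 h : measurable_fun setT h ->
  (forall y, 0 <= h y) ->
  \int[m]_y (h y * (\1_[set y | Phi h y = 0] y)%:E) = 0.
Proof.
move=> mh h0; set C := [set y | _].
have mC : measurable C.
  rewrite (_ : C = setT `&` Phi h @^-1` [set 0]); last by rewrite setTI.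
  exact: measurable_orbit_integral.
have mhC : measurable_fun setT (fun y => h y * (\1_C y)%:E).
  by apply: emeasurable_funM => //; apply/measurable_EFinP;
    exact: measurable_indic.
have hC0 y : 0 <= h y * (\1_C y)%:E by rewrite mule_ge0// lee_fin.
have rT : rho setT != 0 by rewrite (radon_setT clH.1 hrho.1) (radon_neq0
  hrho.1).
have := orbit_integral_adjoint (f := cst 1) (g := fun y => h y * (\1_C y)%:E)
  (measurable_cst _) mhC (fun _ => lee01) hC0.
under eq_integral do rewrite /orbit_integral integral_cst// mul1e.
rewrite ge0_integralZr//.
rewrite [RHS](_ : _ = 0); last first.
  apply: integral0_eq => y _; rewrite mul1e orbit_integral_indicM//.
    rewrite indicE; have [/set_mem ->|_] := boolP (y \in C);
      first by rewrite mul0e.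
    by rewrite mule0.
  by move=> s z Hs; rewrite /C/= orbit_integral_invariant.
by move/eqP; rewrite mule_eq0 (negbTE rT) orbF => /eqP.
Qed.

(* By invariance, [u = h 1_B / Phi h] satisfies [Phi u = 1_B], so that
   [\int_B f = \int f Phi u = \int u Phi f >= lam \int_B h]. *)
Lemma maximal_step (B : set Y) (lam : R) f h :
  measurable_fun setT f -> measurable_fun setT h ->
  (forall y, 0 <= f y) -> (forall y, 0 <= h y) ->
  measurable B -> (forall s y, H s -> B (act s y) = B y) -> (0 <= lam)%R ->
  (forall y, B y -> [/\ 0 < Phi h y, Phi h y < +oo & lam%:E * Phi h y <= Phi f
    y]) ->
  lam%:E * \int[m]_y (h y * (\1_B y)%:E) <= \int[m]_y (f y * (\1_B y)%:E).
Proof.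
move=> mf mh f0 h0 mB invB lam0 BP.
have mIB : measurable_fun setT (fun z => (\1_B z)%:E : \bar R).
  by apply/measurable_EFinP; exact: measurable_indic.
have IB0 y : 0 <= (\1_B y)%:E :> \bar R by rewrite lee_fin.
have mPh := measurable_orbit_integral mh h0.
have mPf := measurable_orbit_integral mf f0.
(* [q] is the inverse of [Phi h] where that is positive and finite, in particular on [B]. Elsewhere
   it takes the default value 0. *)
pose q y := ((fine (Phi h y))^-1)%:E.
have q0 y : 0 <= q y by rewrite lee_fin invr_ge0 fine_ge0// orbit_integral_ge0.
have PhqE y : 0 < Phi h y -> Phi h y < +oo -> Phi h y * q y = 1.
  move=> P0 Poo; have Pfin : Phi h y \is a fin_num by rewrite gt0_fin_numE.
  have fP0 : (0 < fine (Phi h y))%R by rewrite fine_gt0// P0 Poo.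
  by rewrite -{1}(fineK Pfin) /q -EFinM mulfV// gt_eqF.
have mq : measurable_fun setT q.
  apply/measurable_EFinP.
  (* On non-negative reals the inverse is the power -1, also at 0, and power functions are
     measurable. *)
  apply: (eq_measurable_fun (fun y => (fine (Phi h y) `^ (-1))%R)) => [y _|].
    by rewrite powR_inv1// fine_ge0// orbit_integral_ge0.
  apply: (measurableT_comp (measurable_powR (-1)%R)).
  exact: (measurableT_comp (fine_measurable measurableT)).
pose u y := h y * q y * (\1_B y)%:E.
have mhq : measurable_fun setT (fun y => h y * q y) by exact: emeasurable_funM.
have hq0 y : 0 <= h y * q y by rewrite mule_ge0.
have mu_ : measurable_fun setT u by exact: emeasurable_funM.
have u0 y : 0 <= u y by rewrite mule_ge0.
have Phu y : Phi u y = (\1_B y)%:E.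
  rewrite /u orbit_integral_indicM// indicE.
  have [/set_mem By|_] := boolP (y \in B); last by rewrite mule0.
  have [P0 Poo _] := BP y By.
  rewrite mule1 /orbit_integral.
  (* [Phi h] is constant along [H]-orbits, so [q] may be frozen at [y]. *)
  transitivity (\int[rho]_t (h (act t y) * q y)).
    have mhy : measurable_fun [set: borel G] (fun t : G => h (act t y)).
      exact: (measurableT_comp mh (measurable_orbit y)).
    apply: (eq_integral_subgroup clH hrho).
    - apply: emeasurable_funM => //; exact: (measurableT_comp mq
        (measurable_orbit y)).
    - exact: emeasurable_funM.
    - by move=> t.
    - by move=> t; rewrite mule_ge0.
    - by move=> t Ht; rewrite /q orbit_integral_invariant.
  rewrite ge0_integralZr//; last first.
    exact: (measurableT_comp mh (measurable_orbit y)).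
  exact: PhqE.
have <- : \int[m]_y (u y * Phi f y) = \int[m]_y (f y * (\1_B y)%:E).
  by rewrite orbit_integral_adjoint//; apply: eq_integral => y _; rewrite Phu.
rewrite -ge0_integralZl//; [|exact: emeasurable_funM|by move=> y _;
  rewrite mule_ge0].
have Pf0 y := @orbit_integral_ge0 f y f0.
apply: ge0_le_integral => //.
- by move=> y _; rewrite mule_ge0 ?lee_fin// mule_ge0.
- by apply: emeasurable_funM => //; exact: emeasurable_funM.
- exact: emeasurable_funM.
- move=> y _; rewrite /u indicE.
  have [/set_mem By|_] := boolP (y \in B); last by rewrite !mule0 mul0e.
  rewrite !mule1; have [P0 Poo lamP] := BP y By.
  rewrite muleC -muleA lee_wpmul2l//.
  have -> : lam%:E = q y * (lam%:E * Phi h y).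
    by rewrite muleCA [q y * _]muleC PhqE// mule1.
  by rewrite lee_wpmul2l.
Qed.

End one_subgroup.
End gspace.

(** * The maximal inequality along the increasing subgroups *)

Section maximal.
Context (R : realType) (G : topologicalGroupType).
Hypothesis hG : locally_compact_group G.
Context dY (Y : measurableType dY) (m : {measure set Y -> \bar R}).
Context (act : G -> Y -> Y) (Delta : G -> R).
Hypothesis sfm : sigma_finite setT m.
Hypothesis mact : measurable_fun [set: borel G * Y]
  (fun z : borel G * Y => act z.1 z.2).
Hypothesis actM : forall s t y, act (s * t)%g y = act s (act t y).
Hypothesis act1 : forall y, act 1%g y = y.
Hypothesis mrel : forall s (A : set Y), measurable A ->
  m (act s @^-1` A) = (Delta s)%:E * m A.
Hypothesis Delta0 : forall s, (0 <= Delta s)%R.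
Hypothesis mDelta : measurable_fun [set: borel G] Delta.
Context (H : nat -> set G) (rho : nat -> {measure set (borel G) -> \bar R}).
Hypothesis clH : forall n, closed_subgroup (H n).
Hypothesis hrho : forall n, right_haar_measure (H n) (rho n).
Hypothesis Hincr : forall n, H n `<=` H n.+1.
Hypothesis hD : forall n, modular_function (H n) Delta.

Local Notation Phi n := (orbit_integral act (rho n)).

(** The ratio Phi_n f / Phi_n h exceeds [lam], in product form; the two bounds on Phi_n h make this
    ratio meaningful and are those that [maximal_step] asks for. *)
Definition exceed (lam : R) f h n :=
  [set y | [/\ 0 < Phi n h y, Phi n h y < +oo & lam%:E * Phi n h y < Phi n f
    y]].

Lemma measurable_exceed lam f h n :
  measurable_fun setT f -> measurable_fun setT h ->
  (forall y, 0 <= f y) -> (forall y, 0 <= h y) -> measurable (exceed lam f h n).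
Proof.
move=> mf mh f0 h0.
have mPh := measurable_orbit_integral hG mact (hrho n) mh h0.
have mPf := measurable_orbit_integral hG mact (hrho n) mf f0.
rewrite (_ : exceed _ _ _ _ = [set y | 0 < Phi n h y] `&`
  [set y | Phi n h y < +oo] `&` [set y | lam%:E * Phi n h y < Phi n f y]); last
    first.
  by apply/seteqP; split=> [y []|y [[]]].
apply: measurableI; first apply: measurableI.
- by rewrite -[X in measurable X]setTI; exact: emeasurable_fun_o_infty.
- by rewrite -[X in measurable X]setTI; exact: emeasurable_fun_infty_o.
- rewrite -[X in measurable X]setTI; apply: measurable_lte => //.
  exact: measurable_funeM.
Qed.

Let H_le i j : (i <= j)%N -> H i `<=` H j.
Proof.
elim: j => [|j IH]; first by rewrite leqn0 => /eqP ->.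
by rewrite leq_eqVlt => /predU1P[->//|/IH]; move/subset_trans; apply.
Qed.

(** Induction on [N], peeling off the last index first. The part of [Z] where the threshold is
    exceeded at [N] is invariant under [H N] and falls under [maximal_step]. The rest of [Z] is
    still invariant under the smaller subgroups, so the induction hypothesis applies to it; this is
    why the statement carries an arbitrary invariant set [Z]. *)
Lemma maximal_finite (lam : R) f h N (Z : set Y) :
  measurable_fun setT f -> measurable_fun setT h ->
  (forall y, 0 <= f y) -> (forall y, 0 <= h y) -> (0 <= lam)%R ->
  measurable Z ->
  (forall i s y, (i < N)%N -> H i s -> Z (act s y) = Z y) ->
  let U := \bigcup_(i < N) exceed lam f h i in
  lam%:E * \int[m]_y (h y * (\1_(U `&` Z) y)%:E)
    <= \int[m]_y (f y * (\1_(U `&` Z) y)%:E).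
Proof.
move=> mf mh f0 h0 lam0.
rewrite /=; elim: N Z => [|N IH] Z mZ invZ;
  set U := (X in _ * \int[_]_y (_ * (\1_(X `&` _) y)%:E)).
  rewrite /U bigcup_mkord big_ord0 set0I.
  under eq_integral do rewrite indic0 mule0.
  under [leRHS]eq_integral do rewrite indic0 mule0.
  by rewrite integral0 mule0.
set A := exceed lam f h N.
have mA : measurable A by exact: measurable_exceed.
set V := \bigcup_(i < N) exceed lam f h i.
have mV : measurable V by apply: bigcup_measurable => i _;
  exact: measurable_exceed.
have invA s y : H N s -> A (act s y) = A y.
  by move=> Hs; rewrite /A /exceed/= !(orbit_integral_invariant mact actM (clH
    N) (hrho N)).
pose Z1 := A `&` Z; pose Z2 := Z `\` A.
have mZ1 : measurable Z1 by exact: measurableI.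
have mZ2 : measurable Z2 by exact: measurableD.
have step1 : lam%:E * \int[m]_y (h y * (\1_Z1 y)%:E) <= \int[m]_y (f y * (\1_Z1
  y)%:E).
  apply: (maximal_step hG sfm mact actM act1 mrel Delta0 mDelta (clH N) (hrho N)
    (@hD N)) => //.
  - by move=> s y Hs; rewrite /Z1/= invA// (@invZ N s y).
  - by move=> y [[P0 Poo /ltW]].
have step2 : lam%:E * \int[m]_y (h y * (\1_(V `&` Z2) y)%:E)
    <= \int[m]_y (f y * (\1_(V `&` Z2) y)%:E).
  apply: IH => // i s y iN His; rewrite /Z2/= (@invZ i)//; last exact: ltnW.
  by rewrite invA//; apply: H_le His; exact: ltnW.
have split_integral g : measurable_fun setT g -> (forall y, 0 <= g y) ->
    \int[m]_y (g y * (\1_(U `&` Z) y)%:E) = \int[m]_y (g y * (\1_Z1 y)%:E)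
      + \int[m]_y (g y * (\1_(V `&` Z2) y)%:E).
  move=> mg g0; rewrite -ge0_integralD//.
  - apply: eq_integral => y _; rewrite -ge0_muleDr ?lee_fin//; congr (_ * _).
    rewrite -EFinD; congr (_%:E).
    have -> : U `&` Z = Z1 `|` (V `&` Z2).
      rewrite /U bigcup_mkord big_ord_recr/= -bigcup_mkord -/V -/A.
      apply/seteqP; split=> [z [[Vz|Az] Zz]|z [[Az Zz]|[Vz [Zz _]]]].
      + by have [Az|nAz] := pselect (A z); [left|right].
      + by left.
      + by split => //; right.
      + by split => //; left.
    rewrite !indicE in_setU.
    have [/set_mem[Ay _]|_] := boolP (y \in Z1); last by rewrite add0r.
    have [/set_mem[_ [_ /(_ Ay)]]//|_] := boolP (y \in V `&` Z2).
    by rewrite addr0.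
  - by move=> y _; rewrite mule_ge0 ?lee_fin.
  - apply: emeasurable_funM => //; apply/measurable_EFinP;
      exact: measurable_indic.
  - by move=> y _; rewrite mule_ge0 ?lee_fin.
  - apply: emeasurable_funM => //; apply/measurable_EFinP.
    by apply: measurable_indic; exact: measurableI.
rewrite !split_integral// ge0_muleDr; first exact: leeD.
- by apply: integral_ge0 => y _; rewrite mule_ge0 ?lee_fin.
- by apply: integral_ge0 => y _; rewrite mule_ge0 ?lee_fin.
Qed.

(** Monotone limit of the finite version, taken with [Z] the whole space, after bounding [f] times
    an indicator by [f]. *)
Lemma maximal_inequality (lam : R) f h :
  measurable_fun setT f -> measurable_fun setT h ->
  (forall y, 0 <= f y) -> (forall y, 0 <= h y) -> (0 <= lam)%R ->
  lam%:E * \int[m]_(y in \bigcup_n exceed lam f h n) h y <= \int[m]_y f y.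
Proof.
move=> mf mh f0 h0 lam0.
pose U N := \bigcup_(i < N) exceed lam f h i.
have mE n : measurable (exceed lam f h n) by exact: measurable_exceed.
have mU N : measurable (U N) by exact: bigcup_measurable.
have UE : \bigcup_n exceed lam f h n = \bigcup_N U N.
  apply/seteqP; split=> [y [n _ En]|y [N _ [n _ En]]]; last by exists n.
  by exists n.+1 => //; exists n => /=.
have ndU : nondecreasing_seq U.
  move=> i j ij; apply/subsetPset; apply: bigcup_sub => k /= ki.
  by apply: bigcup_sup => /=; exact: leq_trans ki ij.
have cvgU : \int[m]_(y in U n) h y @[n --> \oo] --> \int[m]_(y in \bigcup_n U n)
  h y.
  apply: ge0_nondecreasing_set_cvg_integral => //.
  - by move=> n; exact: measurable_funTS.
rewrite UE.
have := cvgeZl (isT : lam%:E \is a fin_num) cvgU.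
move=> /cvg_lim <- //; apply: lime_le.
  by apply: is_cvgeZl => //; apply/cvg_ex; eexists; exact: cvgU.
apply: nearW => N.
have := @maximal_finite lam f h N setT mf mh f0 h0 lam0 measurableT.
rewrite /= setIT => /(_ (fun _ _ _ _ _ => erefl)).
rewrite -/(U N).
have hU : \int[m]_(y in U N) h y = \int[m]_y (h y * (\1_(U N) y)%:E).
  rewrite integral_mkcond; apply: eq_integral => y _; rewrite patchE indicE.
  by case: ifP; rewrite ?mule1 ?mule0.
rewrite hU => /le_trans; apply; apply: ge0_le_integral => //.
- by move=> y _; rewrite mule_ge0 ?lee_fin.
- apply: emeasurable_funM => //; apply/measurable_EFinP;
    exact: measurable_indic.
- move=> y _; rewrite indicE; case: (y \in _); first by rewrite mule1.
  by rewrite mule0.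
Qed.

End maximal.

(** * Convergence on the group *)

Section density.
Context (R : realType) (G : topologicalGroupType).
Hypothesis hG : locally_compact_group G.
Context (H : set G) (m : {measure set (borel G) -> \bar R}).
Hypothesis hm : radon_measure_on H m.

Let hdG : hausdorff_space G. Proof. by case: hG. Qed.
Let lcG : locally_compact [set: G]. Proof. by case: hG. Qed.

Let measurable_cc (f : G -> R) : cc_fun f -> measurable_fun [set: borel G] (f :
  borel G -> R).
Proof. by case=> cf _; exact: continuous_measurable_real. Qed.

(** Membership in the closure of C_c(G) for the L^1(m) distance. *)
Definition cc_approx (f : G -> R) := forall e : R, (0 < e)%R ->
  exists2 g : G -> R, cc_fun g & \int[m]_x (`|f x - g x|%R)%:E < e%:E.

Let measurable_absB (f g : G -> R) :
  measurable_fun [set: borel G] (f : borel G -> R) ->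
  measurable_fun [set: borel G] (g : borel G -> R) ->
  measurable_fun [set: borel G] (fun x : borel G => (`|f x - g x|%R)%:E).
Proof.
move=> mf mg; apply/measurable_EFinP; apply: measurableT_comp => //.
exact: measurable_funB.
Qed.

Let measure_diff_lt (A B : set (borel G)) (e : R) :
  measurable A -> measurable B ->
  A `<=` B -> m A < +oo -> m B < m A + e%:E -> m (B `\` A) < e%:E.
Proof.
move=> mA mB AB Aoo.
rewrite (measureDI m mB mA) (_ : B `&` A = A); last exact/setIidPr.
by rewrite addeC lteD2lE// ge0_fin_numE.
Qed.

(** Outer regularity gives an open U containing A, and inner regularity of U a compact K inside U,
    each within e/2. A Urysohn function g for K and U satisfies |1_A - g| <= 1_(U - A) + 1_(U - K);
    the second term accounts for the points of A outside K. *)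
Let cc_approx_indic (A : set (borel G)) : measurable A -> m A < +oo ->
  cc_approx (\1_A : borel G -> R).
Proof.
move=> mA Aoo e e0; have e20 : (0 < e / 2)%R by rewrite divr_gt0.
have Afin : m A \is a fin_num by rewrite ge0_fin_numE.
have : ereal_inf [set m U | U in [set U :
  set G | open U /\ A `<=` U]] < m A + (e / 2)%:E.
  by rewrite -(radon_outer hm mA) lteDl// lte_fin.
move=> /ereal_inf_lt[_ [U [oU AU] <-] Ue].
have mU : measurable (U : set (borel G)) by exact: measurable_open.
have Uoo : m U < +oo by apply: lt_trans Ue _; rewrite lte_add_pinfty// ltry.
have Ufin : m U \is a fin_num by rewrite ge0_fin_numE.
have : m U - (e / 2)%:E < ereal_sup [set m K | K in [set K :
  set G | compact K /\ K `<=` U]].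
  by rewrite -(radon_inner hm oU) lteBlDr// lteDl// lte_fin.
move=> /ereal_sup_gt[_ [K [cK KU] <-]]; rewrite lteBlDr// => Ke.
have mK : measurable (K : set (borel G)) by exact: measurable_compact.
have Koo : m K < +oo by exact: radon_compact hm _ cK.
have [g [ccg g01 gK gU]] := exists_cc_fun R hdG lcG cK oU KU.
exists g => //.
apply: (@le_lt_trans _ _ (\int[m]_x ((\1_(U `\` A : set (borel G)) x)%:E
    + (\1_(U `\` K : set (borel G)) x)%:E))).
  apply: ge0_le_integral => //.
  - by apply: measurable_absB; [exact: measurable_indic|exact: measurable_cc].
  - by apply: emeasurable_funD; apply/measurable_EFinP; apply: measurable_indic;
      exact: measurableD.
  - move=> x _; rewrite -EFinD lee_fin !indicE.
    have /andP[g0 g1] := g01 x.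
    have [Ux|nUx] := pselect (U x); last first.
      rewrite gU// memNset; last by move/AU.
      by rewrite subrr normr0 addr_ge0.
    have [Ax|nAx] := pselect (A x).
      rewrite mem_set// ger0_norm ?subr_ge0//.
      have [Kx|nKx] := pselect (K x); first by rewrite gK// subrr addr_ge0.
      have -> : (x \in U `\` K) = true by exact: mem_set.
      by rewrite ler_wpDl// lerBlDr lerDl.
    rewrite memNset// sub0r normrN ger0_norm//.
    have -> : (x \in U `\` A) = true by exact: mem_set.
    by rewrite (le_trans g1)// lerDl.
rewrite ge0_integralD//.
- rewrite !integral_indic ?setIT//; [|exact: measurableD|exact: measurableD].
  rewrite [e]splitr EFinD lteD//; exact: measure_diff_lt.
- by apply/measurable_EFinP; apply: measurable_indic; exact: measurableD.
- by apply/measurable_EFinP; apply: measurable_indic; exact: measurableD.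
Qed.

Let cc_approx_le (f : G -> R) : measurable_fun [set: borel G] (f :
  borel G -> R) ->
  (forall e : R, (0 < e)%R -> exists g : G -> R,
    [/\ measurable_fun [set: borel G] (g : borel G -> R), cc_approx g &
        \int[m]_x (`|f x - g x|%R)%:E < e%:E]) -> cc_approx f.
Proof.
move=> mf fP e e0; have e20 : (0 < e / 2)%R by rewrite divr_gt0.
have [g [mg gP fg]] := fP _ e20.
have [h cch gh] := gP _ e20.
have mh := measurable_cc cch.
exists h => //.
apply: (@le_lt_trans _ _ (\int[m]_x ((`|f x - g x|%R)%:E + (`|g x - h
  x|%R)%:E))).
  apply: ge0_le_integral => //.
  - exact: measurable_absB.
  - by apply: emeasurable_funD; exact: measurable_absB.
  - move=> x _; rewrite -EFinD lee_fin.
    by rewrite (le_trans _ (ler_normD _ _))// subrKA.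
rewrite ge0_integralD//; [|exact: measurable_absB|exact: measurable_absB].
by rewrite [e]splitr EFinD lteD.
Qed.

Let cc_approxD (f1 f2 : G -> R) : measurable_fun [set: borel G] (f1 :
  borel G -> R) ->
  measurable_fun [set: borel G] (f2 : borel G -> R) ->
  cc_approx f1 -> cc_approx f2 -> cc_approx (fun x => f1 x + f2 x)%R.
Proof.
move=> mf1 mf2 f1P f2P e e0; have e20 : (0 < e / 2)%R by rewrite divr_gt0.
have [g1 ccg1 fg1] := f1P _ e20; have [g2 ccg2 fg2] := f2P _ e20.
have mg1 := measurable_cc ccg1; have mg2 := measurable_cc ccg2.
exists (fun x => g1 x + g2 x)%R; first exact: cc_funD.
apply: (@le_lt_trans _ _ (\int[m]_x ((`|f1 x - g1 x|%R)%:E + (`|f2 x - g2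
  x|%R)%:E))).
  apply: ge0_le_integral => //.
  - by apply: measurable_absB; exact: measurable_funD.
  - by apply: emeasurable_funD; exact: measurable_absB.
  - move=> x _; rewrite -EFinD lee_fin.
    by rewrite (le_trans _ (ler_normD _ _))// opprD addrACA.
rewrite ge0_integralD//; [|exact: measurable_absB|exact: measurable_absB].
by rewrite [e]splitr EFinD lteD.
Qed.

Let cc_approxZ (c : R) (f : G -> R) : measurable_fun [set: borel G] (f :
  borel G -> R) ->
  cc_approx f -> cc_approx (fun x => c * f x)%R.
Proof.
move=> mf fP e e0; have c1 : (0 < `|c| + 1)%R by rewrite ltr_wpDl.
have ec0 : (0 < e / (`|c| + 1))%R by rewrite divr_gt0.
have [g ccg fg] := fP _ ec0; have mg := measurable_cc ccg.
exists (fun x => c * g x)%R; first exact: cc_funZ.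
under eq_integral do rewrite -mulrBr normrM EFinM.
rewrite ge0_integralZl_EFin//; last exact: measurable_absB.
apply: (@le_lt_trans _ _ ((`|c| + 1)%:E * \int[m]_x (`|f x - g x|%R)%:E)).
  rewrite lee_wpmul2r//; first by apply: integral_ge0.
  by rewrite lee_fin lerDl.
by rewrite -lte_pdivlMl// -EFinM mulrC.
Qed.

Let cc_approx0 : cc_approx (cst 0%R).
Proof.
move=> e e0; exists (cst 0%R); first exact: cc_fun0.
by under eq_integral do rewrite subrr normr0; rewrite integral0 lte_fin.
Qed.

Import HBSimple.

(** Integrable simple functions are dense in L^1, and by linearity each of them reduces to
    indicators of its level sets. *)
Lemma cc_fun_dense (f : borel G -> R) (e : R) :
  m.-integrable setT (EFin \o f) ->
  (0 < e)%R -> exists2 g : G -> R, cc_fun g & \int[m]_x (`|f x - g x|%R)%:E <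
    e%:E.
Proof.
move=> fi; move: e; change (cc_approx f).
have mf : measurable_fun [set: borel G] (f : borel G -> R).
  by apply/measurable_EFinP; exact: measurable_int fi.
have [s [si _ sf]] := approximation_sfun_integrable measurableT fi.
apply: cc_approx_le => // e e0.
have [n _ sn] : \forall n \near \oo, \int[m]_z `|(f z)%:E - (s n z)%:E| < e%:E.
  apply: (sf [set y | y < e%:E]); apply: open_nbhs_nbhs; split.
    exact: open_ereal_lt_ereal.
  by rewrite /= lte_fin.
exists (s n); split=> //; last exact: sn (leqnn n).
have fins : finite_set (range (s n)) by [].
have mlevel r : measurable (s n @^-1` [set r]) by exact: measurable_funPTI.
rewrite (_ : (s n : G -> R) = fun x =>
    (\sum_(r <- fset_set (range (s n))) r * \1_(s n @^-1` [set r]) x)%R); last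
      first.
  by apply/funext => x; rewrite {1}fimfunE fsbig_finite.
elim: (fset_set _ : seq R) => [|r l IH].
  by under eq_fun do rewrite big_nil; exact: cc_approx0.
under eq_fun do rewrite big_cons.
have mterm r' : measurable_fun [set: borel G]
    (fun x : borel G => r' * \1_(s n @^-1` [set r']) x)%R.
  by apply: measurable_funM => //; exact: measurable_indic.
apply: cc_approxD => //; first exact: measurable_sum.
(* The level set of 0 may have infinite measure, but its term vanishes. For [r] nonzero, Markov's
   inequality makes the level set of finite measure. *)
have [->|r0] := eqVneq r 0%R.
  by under eq_fun do rewrite mul0r; exact: cc_approx0.
apply: cc_approxZ; first exact: measurable_indic.
apply: cc_approx_indic => //.
have nr0 : (0 < `|r|)%R by rewrite normr_gt0.
have := le_integral_abse m measurableT (measurable_int m (si n)) nr0.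
rewrite setTI => le_r.
have /integrableP[_ sioo] := si n.
apply: (@le_lt_trans _ _ (m [set x | `|r|%:E <= `|(EFin \o s n) x|])).
  apply: le_measure; [exact: mem_set| |by move=> x /= ->].
    apply: mem_set; rewrite -[X in measurable X]setTI.
    apply: emeasurable_fun_c_infty => //.
    by apply: measurableT_comp => //; exact: measurable_int (si n).
have := le_lt_trans le_r sioo.
rewrite -lte_pdivlMl// => /lt_le_trans; apply; exact: leey.
Qed.

End density.

(* Multiplication need not be measurable for the product of the Borel
   sigma-algebra of [G] with itself. It becomes so when the second factor (and
   the codomain) is [G] with the coarser sigma-algebra generated by an orbit map
   and the continuous functions. *)
Section orbit_space.
Context (R : realType) (G : topologicalGroupType).
Hypothesis hG : locally_compact_group G.
Context d (X : measurableType d) (act : G -> X -> X).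
Hypothesis mact : measurable_fun [set: borel G * X]
  (fun z : borel G * X => act z.1 z.2).
Hypothesis actM : forall s t x, act (s * t)%g x = act s (act t x).
Variable x0 : X.

Definition orbit_system : set_system G :=
  [set A | (exists2 E : set X, measurable E & A = [set s | E (act s x0)]) \/
    (exists2 f : G -> R, continuous f & A = [set s | 0 < f s]%R)].

Local Notation Y := (g_sigma_algebraType orbit_system).

Let orbit_cozero : contains_cozero R orbit_system.
Proof. by move=> f cf; right; exists f. Qed.

Lemma measurable_orbit_space : measurable_fun [set: Y] (fun s : G => act s x0).
Proof.
move=> _ E mE; rewrite setTI; apply: sub_gen_smallest; left; by exists E.
Qed.

Lemma measurable_cts_orbit_space (f : G -> R) : continuous f ->
  measurable_fun [set: Y] (f : Y -> R).
Proof.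
move=> cf; apply: (measurability _ (RGenOInfty.measurableE R)).
move=> _ [_ [c ->] <-]; rewrite setTI; apply: sub_gen_smallest; right.
exists (fun s => f s - c)%R; first by move=> s; apply: cvgB;
  [exact: cf|exact: cvg_cst].
by apply/seteqP; split=> s; rewrite /= in_itv /= andbT subr_gt0.
Qed.

Lemma measurable_id_orbit_space : measurable_fun [set: borel G] (id :
  borel G -> Y).
Proof.
apply: (measurability _ (erefl (measurable : set_system Y))).
move=> _ [A [[E mE ->]|[f cf ->]] <-]; rewrite setTI.
- rewrite -[X in measurable X]setTI.
  exact: (measurable_fun_pair1 x0 mact).
- by apply: measurable_open; exact: contains_cozero_open cf.
Qed.

(** It suffices to treat the two kinds of generators. For those coming from the orbit map, the
    preimage is governed by (t, s) -> t(s x0), which uses the measurable action; for cozero sets, by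
    a continuous function of the product, which [continuous_measurable_prod] handles. *)
Lemma measurable_mul_orbit_space :
  measurable_fun [set: borel G * Y] ((fun z : G * G => (z.1 * z.2)%g) :
    borel G * Y -> Y).
Proof.
apply: (measurability _ (erefl (measurable : set_system Y))).
move=> _ [A [[E mE ->]|[f cf ->]] <-].
- pose h (z : borel G * Y) := act (z.1 : G) (act (z.2 : G) x0).
  have mh : measurable_fun [set: borel G * Y] h.
    apply: (measurableT_comp (f := fun z : borel G * X => act z.1 z.2)
      (g := fun z : borel G * Y => (z.1, act (z.2 : G) x0) :
        borel G * X)) => //.
    apply: measurable_fun_pair => //.
    exact: (measurableT_comp measurable_orbit_space measurable_snd).
  have := mh measurableT E mE; congr measurable.
  by apply/seteqP; split=> z [_ zE]; split=> //; move: zE; rewrite /h /= actM.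
- have cF : continuous (fun z : G * G => f (z.1 * z.2)%g).
    by move=> z; apply: continuous_comp; [exact: mulg_continuous|exact: cf].
  have := continuous_measurable_prod hG orbit_cozero cF measurableT
    (measurable_itv `]0%R, +oo[); congr measurable.
  by apply/seteqP; split=> z [_ /= zE]; split=> //; move: zE;
    rewrite /= in_itv/= andbT.
Qed.

Variable rho : {measure set (borel G) -> \bar R}.
Hypothesis hrho : right_haar_measure [set: G] rho.

(** The restriction of [rho] to the coarser sigma-algebra, obtained as a push-forward by the
    identity map. *)
Definition orbit_measure : {measure set Y -> \bar R}.
Proof.
refine [the {measure set Y -> \bar R} of pushforward rho (id : borel G -> Y)].
exact: measurable_id_orbit_space.
Defined.

Lemma ge0_integral_orbit_measure (f : G -> \bar R) :
  measurable_fun [set: Y] f ->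
  (forall s, 0 <= f s) -> \int[orbit_measure]_s f s = \int[rho]_s f s.
Proof.
move=> mf f0.
rewrite (ge0_integral_pushforward measurable_id_orbit_space rho measurableT
  mf)//.
Qed.

(** The exhaustion must consist of sets of the coarser sigma-algebra. The compact sets K_k are
    therefore enlarged to cozero sets of Urysohn functions equal to 1 on them, whose measure is
    bounded by that of a compact support. *)
Lemma orbit_measure_sigma_finite : sigma_finite setT orbit_measure.
Proof.
have [hd lc _] := hG.
have [K [cK KT _]] := sigma_compact_ndseq hG.
have fP k := exists_cc_fun R hd lc (cK k) openT (@subsetT _ (K k)).
pose f k := sval (cid (fP k)).
have fkP k : [/\ cc_fun (f k), forall x, (0 <= f k x <= 1)%R,
    forall x, K k x -> f k x = 1%R & forall x, ~ [set: G] x -> f k x = 0%R].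
  exact: svalP (cid (fP k)).
exists (fun k => [set s | 0 < f k s]%R).
  apply/seteqP; split=> // s _; have [k _ Kks] :
    (\bigcup_k K k) s by rewrite KT.
  by exists k => //=; have [_ _ -> //] := fkP k.
move=> k; have [[cf sf] _ _ _] := fkP k; split.
  by apply: sub_gen_smallest; right; exists (f k).
apply: (@le_lt_trans _ _ (rho (closure [set t | f k t != 0%R]))).
  apply: (@le_measure _ _ _ rho ([set s | 0 < f k s]%R : set (borel G))).
  - by apply: mem_set; apply: measurable_open; exact: contains_cozero_open.
  - by apply: mem_set; exact: measurable_compact.
  - by move=> s /= fs; apply: subset_closure => /=; rewrite gt_eqF.
exact: radon_compact hrho.1 _ sf.
Qed.

End orbit_space.

Lemma ge0_integral_eq0_ae d (T : measurableType d) (R : realType)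
    (m : {measure set T -> \bar R}) (D : set T) (f : T -> \bar R) :
  measurable D -> measurable_fun D f -> (forall x, 0 <= f x) ->
  \int[m]_(x in D) f x = 0 -> {ae m, forall x, D x -> f x = 0}.
Proof.
move=> mD mf f0 If; apply: (ae_eq_integral_abs m mD mf).1.
by rewrite -[RHS]If; apply: eq_integral => x _; rewrite gee0_abs.
Qed.

Lemma abse_integralB_le d (T : measurableType d) (R : realType)
    (m : {measure set T -> \bar R}) (f g : T -> R) :
  m.-integrable setT (EFin \o f) -> m.-integrable setT (EFin \o g) ->
  `|\int[m]_x (f x)%:E - \int[m]_x (g x)%:E| <= \int[m]_x (`|f x - g x|%R)%:E.
Proof.
move=> fi gi; rewrite -(integralB measurableT fi gi).
apply: (le_trans (le_abse_integral _ _ _)) => //.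
by apply: emeasurable_funB; [exact: measurable_int fi|exact: measurable_int gi].
Qed.

Lemma integrable_L1_close d (T : measurableType d) (R : realType)
    (m : {measure set T -> \bar R}) (f g : T -> R) :
  measurable_fun setT f -> m.-integrable setT (EFin \o g) ->
  \int[m]_x (`|f x - g x|%R)%:E < +oo -> m.-integrable setT (EFin \o f).
Proof.
move=> mf gi fgoo; have mg : measurable_fun setT g.
  by apply/measurable_EFinP; exact: measurable_int gi.
have fgi : m.-integrable setT (EFin \o (fun x => f x - g x)%R).
  apply/integrableP; split=> //.
  by apply/measurable_EFinP; exact: measurable_funB.
have := integrableD measurableT fgi gi.
by apply: eq_integrable => // x _; rewrite /= -EFinD subrK.
Qed.

Section translate.
Context (R : realType) (G : topologicalGroupType).
Hypothesis hG : locally_compact_group G.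

Lemma cc_fun_translate (f : G -> R) (s : G) : cc_fun f ->
  cc_fun (fun t => f (t * s)%g).
Proof.
move=> [cf sf]; split.
  by move=> t; apply: continuous_comp; [exact: mulgr_cont|exact: cf].
set K := closure _ in sf.
have KE : (fun t : G => (t * s^-1)%g) @` K = [set t | K (t * s)%g].
  apply/seteqP; split=> [_ [t Kt <-]|t Kt] /=; first by rewrite mulgVK.
  by exists (t * s)%g => //; rewrite mulgK.
apply: (@compact_closure_support _ _ _ [set t | K (t * s)%g]).
- have -> : [set t | K (t * s)%g] = (fun t : G => (t * s)%g) @^-1` K by [].
  by apply: preimage_closed => [t _|]; [exact: mulgr_cont|exact: closed_closure].
- rewrite -KE; apply: continuous_compact => //.
  by apply: continuous_subspaceT; exact: mulgr_cont.
- by move=> t ft; apply: subset_closure.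
Qed.

Lemma integral_subgroup (H : set G) (m : {measure set (borel G) -> \bar R})
    (f : G -> \bar R) : closed H -> radon_measure_on H m -> m.-integrable setT f
      ->
  \int[m]_(t in H) f t = \int[m]_t f t.
Proof.
move=> cH hm fi; rewrite (negligible_integral _ _ fi (radon_supported hm))//.
- by rewrite setTD setCK.
- by apply: measurableC; exact: measurable_closed.
Qed.

End translate.

(** * Almost everywhere convergence for orbit functions on the group *)

Section jessen.
Context (R : realType) (G : topologicalGroupType).
Hypothesis hG : locally_compact_group G.
Context (Delta : G -> R) (rho : {measure set (borel G) -> \bar R}).
Hypothesis hDelta : modular_function [set: G] Delta.
Hypothesis hrho : right_haar_measure [set: G] rho.
Context (H : nat -> set G) (rho_ : nat -> {measure set (borel G) -> \bar R}).
Hypothesis clH : forall n, closed_subgroup (H n).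
Hypothesis hrho_ : forall n, right_haar_measure (H n) (rho_ n).
Hypothesis hnorm : normalized H rho_ rho.

Lemma modularT_ge0 s : (0 <= Delta s)%R.
Proof. exact: (modular_ge0 hG (@closed_subgroupT G) hrho hDelta). Qed.

Lemma measurable_modularT : measurable_fun [set: borel G] Delta.
Proof. exact: (measurable_modular hG (@closed_subgroupT G) hrho hDelta). Qed.

Lemma normalized_cc (f : G -> R) : cc_fun f ->
  \int[rho_ n]_t (f t)%:E @[n --> \oo] --> \int[rho]_t (f t)%:E.
Proof.
move=> ccf; have [cf sf] := ccf; have := hnorm cf sf.
under eq_fun do rewrite (integral_subgroup (clH _).1 (hrho_ _).1
  (cc_fun_integrable hG (hrho_ _).1 ccf)).
by [].
Qed.

(** The normalization applies to the translate of [f] by [s], and a convergent sequence is bounded.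
    This is the finiteness of sup_n Phi_n f(s) for [f] in C_c(G). *)
Lemma integral_translate_bounded (f : G -> R) (s : G) : cc_fun f ->
  exists M : R, forall n, \int[rho_ n]_t (f (t * s)%g)%:E <= M%:E.
Proof.
move=> ccf; have cct := cc_fun_translate s ccf.
have fin m K : radon_measure_on K m -> \int[m]_t (f (t * s)%g)%:E \is a fin_num.
  move=> hm; apply: integrable_fin_num => //;
    exact: (cc_fun_integrable hG hm cct).
have := normalized_cc cct; rewrite -(fineK (fin _ _ hrho.1)).
move=> /fine_cvgP[_ /cvgP/cvg_seq_bounded[M [_ MP]]].
exists (M + 1)%R => n; rewrite -(fineK (fin _ _ (hrho_ n).1)) lee_fin.
rewrite (le_trans (ler_norm _))//; apply: (MP (M + 1)%R) => //.
by rewrite ltrDl.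
Qed.

End jessen.

Section jessen_orbit.
Context (R : realType) (G : topologicalGroupType).
Hypothesis hG : locally_compact_group G.
Context (Delta : G -> R) (rho : {measure set (borel G) -> \bar R}).
Hypothesis hDelta : modular_function [set: G] Delta.
Hypothesis hrho : right_haar_measure [set: G] rho.
Context (H : nat -> set G) (rho_ : nat -> {measure set (borel G) -> \bar R}).
Hypothesis clH : forall n, closed_subgroup (H n).
Hypothesis hrho_ : forall n, right_haar_measure (H n) (rho_ n).
Hypothesis Hincr : forall n, H n `<=` H n.+1.
Hypothesis hD : forall n, modular_function (H n) Delta.
Hypothesis hnorm : normalized H rho_ rho.
Context d (X : measurableType d) (act : G -> X -> X).
Hypothesis mact : measurable_fun [set: borel G * X]
  (fun z : borel G * X => act z.1 z.2).
Hypothesis actM : forall s t x, act (s * t)%g x = act s (act t x).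
Variable x0 : X.

Local Notation Y := (g_sigma_algebraType (orbit_system R act x0)).
Let mul : G -> Y -> Y := fun s t => (s * (t : G))%g.
Local Notation Phi n := (orbit_integral mul (rho_ n)).

Lemma ae_orbit_measure (P : G -> Prop) :
  {ae orbit_measure mact x0 rho, forall s, P s} -> {ae rho, forall s, P s}.
Proof.
move=> [A [mA A0 PA]]; exists A; split => //.
by rewrite -[X in measurable X]setTI; exact: (measurable_id_orbit_space mact).
Qed.

(** An e/3 argument at a fixed point [s], through an approximation [phi j] in C_c(G): the error
    under [rho] is controlled by the L^1 distance, the error under [rho_ n] uniformly in [n] by the
    comparison with [psi], and the middle term by the normalization. Arbitrarily large [j] suffice,
    because [j] is chosen before [n]. *)
Lemma jessen_pointwise (F : G -> R) (phi : nat -> G -> R) (psi : G -> R) (s :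
  G) :
  measurable_fun [set: borel G] (fun t : borel G => F (t * s)%g) ->
  rho.-integrable setT (EFin \o F) ->
  (forall j, cc_fun (phi j)) -> cc_fun psi ->
  (forall j, \int[rho]_t (`|F t - phi j t|%R)%:E <= (j.+1%:R^-1 ^+ 2)%:E) ->
  (forall k, exists2 j, (k <= j)%N & forall n,
    Phi n (fun t => (`|F t - phi j t|%R)%:E) s
      <= j.+1%:R^-1%:E * Phi n (EFin \o psi) s) ->
  (forall n, (rho_ n).-integrable setT (fun t => (F (t * s)%g)%:E)) /\
  \int[rho_ n]_t (F (t * s)%g)%:E @[n --> \oo] --> \int[rho]_t (F t)%:E.
Proof.
move=> mFs Fi ccphi ccpsi phiF jP.
have [M PhiM] := integral_translate_bounded hG hrho clH hrho_ hnorm s ccpsi.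
have jM k : exists2 j, (k <= j)%N & forall n,
    \int[rho_ n]_t (`|F (t * s)%g - phi j (t * s)%g|%R)%:E <= (j.+1%:R^-1 *
      M)%:E.
  have [j kj jn] := jP k; exists j => // n; apply: le_trans (jn n) _.
  by rewrite EFinM lee_wpmul2l ?lee_fin//; exact: PhiM.
have phii n j : (rho_ n).-integrable setT (EFin \o (fun t => phi j (t * s)%g)).
  by apply: (cc_fun_integrable hG (hrho_ n).1); exact: cc_fun_translate.
have FsI n : (rho_ n).-integrable setT (EFin \o (fun t => F (t * s)%g)).
  have [j _ /(_ n) jn] := jM 0%N.
  by apply: (integrable_L1_close mFs (phii n j)); apply: le_lt_trans jn _;
    rewrite ltry.
split; first exact: FsI.
have Ffin : \int[rho]_t (F t)%:E \is a fin_num by exact: integrable_fin_num.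
have Fsfin n : \int[rho_ n]_t (F (t * s)%g)%:E \is a fin_num.
  by apply: integrable_fin_num => //; exact: FsI.
rewrite -(fineK Ffin); apply/fine_cvgP; split; first exact: nearW.
apply/cvgrPdist_le => e e0.
have e30 : (0 < e / 3)%R by rewrite divr_gt0.
have M1 : (0 < `|M| + 1)%R by rewrite ltr_wpDl.
have eM0 : (0 < e / 3 / (`|M| + 1))%R by rewrite divr_gt0.
(* The first bound controls the error under [rho], the second the error under [rho_ n]; [|M| + 1] is
   a positive number above [M]. *)
have min0 : (0 < Num.min (e / 3) (e / 3 / (`|M| + 1)))%R by rewrite lt_min e30.
have [k] := ltr_add_invr min0; rewrite add0r lt_min => /andP[ke keM].
have [j kj jn] := jM k.
have jk : (j.+1%:R^-1 <= k.+1%:R^-1 :> R)%R.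
  by rewrite lef_pV2 ?posrE// ler_nat ltnS.
have jM3 : (j.+1%:R^-1 * M <= e / 3)%R.
  rewrite (@le_trans _ _ (j.+1%:R^-1 * (`|M| + 1))%R)//.
    by rewrite ler_wpM2l// (le_trans (ler_norm M))// lerDl.
  by rewrite -ler_pdivlMr// (le_trans jk)// ltW.
have j13 : (j.+1%:R^-1 ^+ 2 <= e / 3 :> R)%R.
  rewrite expr2 (@le_trans _ _ (j.+1%:R^-1)%R)//; last by rewrite (le_trans
    jk)// ltW.
  by rewrite ler_piMr// invf_le1// ler1n.
have ccj := cc_fun_translate s (ccphi j).
have phirho : rho.-integrable setT (EFin \o phi j) by exact: (cc_fun_integrable
  hG hrho.1).
have phiE : \int[rho]_t (phi j (t * s)%g)%:E = \int[rho]_t (phi j t)%:E.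
  have mphi : measurable_fun [set: borel G] (phi j).
    by apply: continuous_measurable_real; case: (ccphi j).
  have mphiE : measurable_fun [set: borel G] (EFin \o phi j) by
    exact/measurable_EFinP.
  have sT : [set: G] s by [].
  (* Right invariance was established for non-negative integrands, hence the splitting into positive
     and negative parts. *)
  rewrite integralE [RHS]integralE; congr (_ - _).
  - apply: etrans (right_haar_integral (@closed_subgroupT G) hrho sT
      (measurable_funepos mphiE) (funepos_ge0 _)).
    by apply: eq_integral => t _; rewrite !funeposE.
  - apply: etrans (right_haar_integral (@closed_subgroupT G) hrho sT
      (measurable_funeneg mphiE) (funeneg_ge0 _)).
    by apply: eq_integral => t _; rewrite !funenegE.
have phifin : \int[rho]_t (phi j t)%:E \is a fin_num by exact:
  integrable_fin_num.
have phisfin n : \int[rho_ n]_t (phi j (t * s)%g)%:E \is a fin_num.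
  by apply: integrable_fin_num => //; exact: phii.
have := normalized_cc hG clH hrho_ hnorm ccj.
rewrite phiE -(fineK phifin) => /fine_cvgP[_ /cvgrPdist_le/(_ _ e30)].
apply: filterS => n /= phin.
have h1 : (`|fine (\int[rho]_t (F t)%:E) - fine (\int[rho]_t (phi j t)%:E)| <= e
  / 3)%R.
  rewrite -lee_fin -abse_EFin EFinB !fineK//.
  rewrite (le_trans (abse_integralB_le Fi phirho))// (le_trans (phiF j))//.
have h2 : (`|fine (\int[rho_ n]_t (F (t * s)%g)%:E)
    - fine (\int[rho_ n]_t (phi j (t * s)%g)%:E)| <= e / 3)%R.
  rewrite -lee_fin -abse_EFin EFinB !fineK//.
  by rewrite (le_trans (abse_integralB_le (FsI n) (phii n j)))//
    (le_trans (jn n)).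
move: phin h1 h2.
set a := fine _; set b := fine _; set c := fine _; set g := fine _.
move=> h1 h2 h3; rewrite distrC in h3; rewrite (_ :
  c - g = (c - a) + ((a - b) + (b - g)))%R; last by ring.
rewrite (le_trans (ler_normD _ _))// [leRHS](_ : e = e / 3 + (e / 3 + e / 3))%R;
  last by field.
by rewrite lerD// (le_trans (ler_normD _ _))// lerD.
Qed.

(** [G] acts on itself by left translation, with the orbit sigma-algebra. The maximal inequality,
    applied to |F - phi_j| against [psi], bounds the exceptional sets E_j in the measure psi rho,
    which is why the conclusion concerns the points where [psi] is positive. *)
Lemma jessen_orbit (f : X -> R) (psi : G -> R) :
  measurable_fun setT f -> rho.-integrable setT (fun t => (f (act t x0))%:E) ->
  cc_fun psi -> (forall s, (0 <= psi s)%R) ->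
  {ae rho, forall s, (0 < psi s)%R ->
    (forall n, (rho_ n).-integrable setT (fun t =>
      (f (act t (act s x0)))%:E)) /\
    \int[rho_ n]_t (f (act t (act s x0)))%:E @[n --> \oo]
      --> \int[rho]_t (f (act t x0))%:E}.
Proof.
move=> mf Fi ccpsi psi0.
pose F (t : G) := f (act t x0).
pose lam j : R := (j.+1%:R^-1)%R.
have lam0 j : (0 < lam j)%R by rewrite invr_gt0.
(* The error is the square of the threshold: after division by [lam j] in the maximal inequality,
   [lam j] remains and tends to 0. *)
have /choice[phi phiP] j : exists g : G -> R, cc_fun g /\
    \int[rho]_t (`|F t - g t|%R)%:E < (lam j ^+ 2)%:E.
  have l2 : (0 < lam j ^+ 2)%R by rewrite exprn_gt0.
  by have [g] := cc_fun_dense hG hrho.1 Fi l2; exists g.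
have [ccphi phiF] := all_and2 phiP.
pose m := orbit_measure mact x0 rho.
have sfm : sigma_finite setT m by exact: orbit_measure_sigma_finite.
have mmul : measurable_fun [set: borel G * Y] ((fun z => mul z.1 z.2) :
  borel G * Y -> Y).
  exact: measurable_mul_orbit_space.
have mulM (s t : G) (y : Y) : mul (s * t)%g y = mul s (mul t y) by rewrite /mul
  mulgA.
have mul1 (y : Y) : mul 1%g y = y by rewrite /mul mul1g.
have mrel s (A : set Y) : measurable A -> m (mul s @^-1` A) = (Delta s)%:E * m
  A.
  move=> mA; have mA' : measurable (A : set (borel G)).
    rewrite -[X in measurable X]setTI.
    exact: (measurable_id_orbit_space mact _ mA).
  exact: (right_haar_preimagel (@closed_subgroupT G) hrho hDelta (I :
    [set: G] s) mA').
have D0 := modularT_ge0 hG hDelta hrho.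
have mDelta := measurable_modularT hG hDelta hrho.
pose psiE (s : Y) := (psi s)%:E.
pose D j (s : Y) := (`|F s - phi j s|%R)%:E.
have mpsiE : measurable_fun setT psiE.
  by apply/measurable_EFinP; apply: measurable_cts_orbit_space; case: ccpsi.
have psiE0 s : 0 <= psiE s by rewrite lee_fin.
have mD j : measurable_fun setT (D j).
  apply/measurable_EFinP; apply: measurableT_comp => //; apply: measurable_funB.
    exact: (measurableT_comp mf (@measurable_orbit_space _ _ _ _ act x0)).
  by apply: measurable_cts_orbit_space; case: (ccphi j).
have D0' j s : 0 <= D j s by rewrite lee_fin.
pose E j := \bigcup_n exceed mul rho_ (lam j) (D j) psiE n.
have mE j : measurable (E j).
  apply: bigcup_measurable => n _.
  exact: (@measurable_exceed _ _ hG _ Y mul mmul H rho_ hrho_).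
have EP j : \int[m]_(s in E j) psiE s <= (lam j)%:E.
  have := @maximal_inequality _ _ hG _ Y m mul Delta sfm mmul mulM mul1 mrel D0
    mDelta H rho_ clH hrho_ Hincr hD (lam j) (D j) psiE (mD j) mpsiE (D0' j)
      psiE0 (ltW (lam0 j)).
  rewrite ge0_integral_orbit_measure// => /le_lt_trans => /(_ _ (phiF j)).
  by rewrite expr2 EFinM lte_pmul2l ?lte_fin// => /ltW.
(* It suffices that [s] avoids [E j] for arbitrarily large [j]. *)
pose N k := \bigcap_(j in [set j | (k <= j)%N]) E j.
have mN k : measurable (N k) by apply: bigcap_measurable => //; exists k => /=.
have IN k : \int[m]_(s in N k) psiE s = 0.
  apply/eqP; rewrite eq_le integral_ge0 ?andbT//.
  apply/lee_addgt0Pr => e e0; rewrite add0e.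
  have [i] := ltr_add_invr e0; rewrite add0r => ie.
  (* [j] is at least [i], so that [lam j] is below [e], and at least [k], so that [N k] is contained
     in [E j]. *)
  pose j := maxn i k.
  rewrite (@le_trans _ _ (\int[m]_(s in E j) psiE s))//.
    apply: ge0_subset_integral => //; first exact: measurable_funTS.
    by apply: bigcap_inf; rewrite /= leq_maxr.
  rewrite (le_trans (EP j))// lee_fin (le_trans _ (ltW ie))//.
  by rewrite lef_pV2 ?posrE// ler_nat ltnS leq_maxl.
have aeN : {ae m, forall s, forall k, N k s -> psiE s = 0}.
  by apply: ae_foralln => k; apply: ge0_integral_eq0_ae => //;
    exact: measurable_funTS.
(* Avoiding [E j] says nothing at a point where Phi_n psi vanishes; among the points where [psi] is
   positive, these form a null set. *)
have aeC : {ae m, forall s, forall n, psiE s * (\1_[set y | Phi n psiE y = 0]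
  s)%:E = 0}.
  apply: ae_foralln => n.
  have mC : measurable ([set y | Phi n psiE y = 0] : set Y).
    rewrite (_ : mkset _ = setT `&` Phi n psiE @^-1` [set 0]); last by rewrite
      setTI.
    exact: (@measurable_orbit_integral _ _ hG _ Y mul mmul (H n) (rho_ n)).
  have : {ae m, forall s, setT s -> psiE s * (\1_[set y | Phi n psiE y = 0]
    s)%:E = 0}.
    apply: ge0_integral_eq0_ae => //.
    - by apply: emeasurable_funM => //; apply/measurable_EFinP;
        exact: measurable_indic.
    - by move=> s; rewrite mule_ge0 ?lee_fin.
    - exact: (@indic_orbit_integral_eq0 _ _ hG _ Y m mul Delta sfm mmul mulM
        mul1
        mrel D0 mDelta (H n) (rho_ n) (clH n) (hrho_ n) (@hD n)).
  by apply: ae_imply => s; apply.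
apply: ae_orbit_measure.
apply: ae_imply2 aeN aeC => s Ns Cs psis.
have psis0 : psiE s != 0 by rewrite gt_eqF// lte_fin.
have Phi0 n : Phi n psiE s != 0.
  apply/eqP => P0; have := Cs n; rewrite indicE mem_set// mule1.
  by move/eqP; rewrite (negbTE psis0).
have Phioo n : Phi n psiE s < +oo.
  have [M PM] := integral_translate_bounded hG hrho clH hrho_ hnorm s ccpsi.
  by apply: le_lt_trans (PM n) _; rewrite ltry.
have [||//|//|j|k|Ii Ic] := @jessen_pointwise F phi psi s.
- apply: (measurableT_comp mf).
  apply: (measurableT_comp (measurable_orbit mact x0)).
  by apply: continuous_measurable_borel; exact: mulgr_cont.
- exact: Fi.
- exact/ltW/phiF.
(* Some [j] above [k] has [s] outside [E j]; since Phi_n psi(s) is positive and finite, the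
   threshold inequality itself must fail for every [n]. *)
- have /existsNP[j /existsNP[kj nEj]] : ~ N k s.
    by move=> /Ns psis00; rewrite psis00 eqxx in psis0.
  exists j => // n; rewrite leNgt; apply/negP => lt_n; apply: nEj.
  by exists n => //; split => //; rewrite lt0e Phi0 orbit_integral_ge0.
- split=> [n|].
    by apply: eq_integrable (Ii n) => // t _; rewrite /F actM.
  by under eq_fun do under eq_integral do rewrite -actM.
Qed.

End jessen_orbit.

(** * Transfer to the space *)

(** Convergence with countable quantifiers only, so that the set of points of convergence is visibly
    measurable. *)
Lemma cvgn_real_archi (R : realType) (u : nat -> R) (l : R) :
  u n @[n --> \oo] --> l <->
  forall k : nat, exists N : nat, forall n,
    (N <= n)%N -> (`|l - u n| <= k.+1%:R^-1)%R.
Proof.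
split=> [/cvgrPdist_le ul k|uP].
  have k0 : (0 < k.+1%:R^-1 :> R)%R by rewrite invr_gt0.
  by have [N _ NP] := ul _ k0; exists N => n /NP.
apply/cvgrPdist_le => e e0; have [k] := ltr_add_invr e0; rewrite add0r => ke.
have [N NP] := uP k; exists N => // n /= /NP /le_trans; apply; exact: ltW.
Qed.

Section transfer.
Context (R : realType) (G : topologicalGroupType).
Hypothesis hG : locally_compact_group G.
Context (Delta : G -> R) (rho : {measure set (borel G) -> \bar R}).
Hypothesis hDelta : modular_function [set: G] Delta.
Hypothesis hrho : right_haar_measure [set: G] rho.
Context (H : nat -> set G) (rho_ : nat -> {measure set (borel G) -> \bar R}).
Hypothesis clH : forall n, closed_subgroup (H n).
Hypothesis hrho_ : forall n, right_haar_measure (H n) (rho_ n).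
Hypothesis Hincr : forall n, H n `<=` H n.+1.
Hypothesis hD : forall n, modular_function (H n) Delta.
Hypothesis hnorm : normalized H rho_ rho.
Context d (X : measurableType d) (mu : {measure set X -> \bar R}) (act :
  G -> X -> X).
Hypothesis sfmu : sigma_finite setT mu.
Hypothesis hact : measured_action mu act.
Hypothesis hmu : relatively_invariant mu Delta act.

Let mact : measurable_fun [set: borel G * X] (fun z :
  borel G * X => act z.1 z.2).
Proof. by case: hact. Qed.
Let act1 x : act 1%g x = x. Proof. by case: hact. Qed.
Let actM s t x : act (s * t)%g x = act s (act t x). Proof. by case: hact. Qed.

Local Notation Phi := (orbit_integral act).

(** Let A be the [G]-invariant set where Phi 1_(B_k) <= M, and g the indicator of its intersection
    with B_k. Then Phi g <= M, and adjointness gives \int g Phi f = \int f Phi g <= M \int f, which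
    is finite. So Phi f is finite almost everywhere on each such intersection, and these cover
    almost all of the space. *)
Lemma orbit_integral_lty (B : nat -> set X) (f : X -> \bar R) :
  (forall k, measurable (B k)) -> \bigcup_k B k = setT ->
  (forall k, {ae mu, forall x, Phi rho (fun y => (\1_(B k) y)%:E) x < +oo}) ->
  measurable_fun setT f -> (forall x, 0 <= f x) -> \int[mu]_x f x < +oo ->
  {ae mu, forall x, Phi rho f x < +oo}.
Proof.
move=> mB BT PhiB mf f0 fi.
have D0 := modularT_ge0 hG hDelta hrho.
have mDelta := measurable_modularT hG hDelta hrho.
have mI k : measurable_fun setT (fun y => (\1_(B k) y)%:E : \bar R).
  by apply/measurable_EFinP; exact: measurable_indic.
have I0 k y : 0 <= (\1_(B k) y)%:E :> \bar R by rewrite lee_fin.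
have mPB k := measurable_orbit_integral hG mact hrho (mI k) (I0 k).
have mPf := measurable_orbit_integral hG mact hrho mf f0.
have Pf0 y := @orbit_integral_ge0 _ _ _ _ act rho f y f0.
pose A k (M : nat) := [set x | Phi rho (fun y => (\1_(B k) y)%:E) x <= M%:R%:E].
have mA k M : measurable (A k M).
  by rewrite -[X in measurable X]setTI; exact: emeasurable_fun_infty_c.
have mIA k M : measurable_fun setT (fun y => (\1_(A k M) y)%:E : \bar R).
  by apply/measurable_EFinP; exact: measurable_indic.
have invA k M s x : [set: G] s -> A k M (act s x) = A k M x.
  by move=> _; rewrite /A/= (orbit_integral_invariant mact actM
    (@closed_subgroupT G) hrho).
pose g k M y : \bar R := (\1_(B k) y)%:E * (\1_(A k M) y)%:E.
have mg k M : measurable_fun setT (g k M) by exact: emeasurable_funM.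
have g0 k M y : 0 <= g k M y by rewrite mule_ge0 ?lee_fin.
have gi k M : \int[mu]_x (g k M x * Phi rho f x) < +oo.
  rewrite (orbit_integral_adjoint hG sfmu mact actM act1 hmu D0 mDelta
    (@closed_subgroupT G) hrho hDelta mf (mg k M) f0 (g0 k M)).
  apply: (@le_lt_trans _ _ (\int[mu]_x (f x * M%:R%:E))).
    apply: ge0_le_integral => //.
    - by move=> y _; rewrite mule_ge0// orbit_integral_ge0.
    - apply: emeasurable_funM => //; exact: (measurable_orbit_integral hG mact
        hrho).
    - exact: emeasurable_funM.
    - move=> y _; rewrite lee_wpmul2l//.
      rewrite (orbit_integral_indicM mact (@closed_subgroupT G) hrho y (mI
        k))//; last first.
        exact: invA.
      rewrite indicE; have [/set_mem Ay|_] := boolP (y \in A k M);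
        first by rewrite mule1.
      by rewrite mule0 lee_fin.
  rewrite ge0_integralZr// ?lee_fin// muleC lte_mul_pinfty// ?lee_fin//.
have aeg : {ae mu, forall x, forall k M, g k M x * Phi rho f x < +oo}.
  apply: ae_foralln => k; apply: ae_foralln => M.
  have ig : mu.-integrable setT (fun x => g k M x * Phi rho f x).
    apply/integrableP; split; first exact: emeasurable_funM.
    by under eq_integral do rewrite gee0_abs ?mule_ge0//.
  apply: ae_imply (integrable_ae measurableT ig) => x /(_ I).
  by rewrite ge0_fin_numE// mule_ge0.
apply: ae_imply2 aeg (ae_foralln PhiB) => x gx Px.
have [k _ Bk] : (\bigcup_k B k) x by rewrite BT.
have [M PM] : exists M : nat, A k M x.
  have Pfin : Phi rho (fun y => (\1_(B k) y)%:E) x \is a fin_num.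
    by rewrite ge0_fin_numE// orbit_integral_ge0.
  exists (Num.truncn (fine (Phi rho (fun y => (\1_(B k) y)%:E) x))).+1.
  by rewrite /A /= -{1}(fineK Pfin) lee_fin ltW// truncnS_gt.
by have := gx k M; rewrite /g !indicE !mem_set// !mul1e.
Qed.

Lemma integral_orbitE (m : {measure set (borel G) -> \bar R}) (f : X -> R) x :
  \int[m]_t (f (act t x))%:E
    = Phi m (EFin \o f)^\+ x - Phi m (EFin \o f)^\- x.
Proof.
rewrite integralE; congr (_ - _); apply: eq_integral => t _.
  by rewrite !funeposE.
by rewrite !funenegE.
Qed.

(** By Tonelli's theorem, for almost every [s] with psi(s) > 0 the point sx lies in [P] for almost
    every [x]. As [psi] has positive integral, such an [s] exists, and quasi-invariance under it
    gives the claim. *)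
Lemma ae_transfer (P : set X) (psi : G -> R) : measurable P ->
  measurable_fun [set: borel G] (psi : borel G -> R) ->
  (forall s, (0 <= psi s)%R) -> 0 < \int[rho]_s (psi s)%:E ->
  {ae mu, forall x, {ae rho, forall s, (0 < psi s)%R -> P (act s x)}} ->
  {ae mu, forall x, P x}.
Proof.
move=> mP mpsi psi0 Ipsi aeP.
have mN : measurable (~` P) by exact: measurableC.
have sfrho : sigma_finite setT rho := radon_sigma_finite hG hrho.1.
pose K (z : borel G * X) := (psi z.1)%:E * (\1_(~` P) (act z.1 z.2))%:E.
have mpsiE : measurable_fun [set: borel G] (EFin \o psi) by
  exact/measurable_EFinP.
have mIN : measurable_fun setT (fun y => (\1_(~` P) y)%:E : \bar R).
  by apply/measurable_EFinP; exact: measurable_indic.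
have mK : measurable_fun setT K.
  apply: emeasurable_funM; first exact: (measurableT_comp mpsiE measurable_fst).
  exact: (measurableT_comp mIN mact).
have K0 z : 0 <= K z by rewrite mule_ge0 ?lee_fin.
have IK0 : \int[mu]_x \int[rho]_s K (s, x) = 0.
  rewrite (@ge0_ae_eq_integral _ _ _ mu setT _ (cst 0)) ?integral0//.
  - exact: measurable_integral1.
  - by move=> x _; apply: integral_ge0.
  - apply: ae_imply aeP => x aePx _.
    rewrite (@ge0_ae_eq_integral _ _ _ rho setT _ (cst 0)) ?integral0//.
    + exact: (measurable_fun_pair1 x mK).
    + apply: ae_imply aePx => s Ps _; rewrite /K/= indicE.
      have [->|psis] := eqVneq (psi s) 0%R; first by rewrite mul0e.
      by rewrite memNset ?mule0//; apply; apply: Ps; rewrite lt0r psis psi0.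
move: IK0; rewrite -(tonelli sfrho sfmu mK K0) => IK0.
have aes : {ae rho, forall s, setT s -> \int[mu]_x K (s, x) = 0}.
  apply: ge0_integral_eq0_ae => //; first exact: measurable_integral2.
  by move=> s; apply: integral_ge0.
(* If the complement of [P] were not null, none of its preimages under [act s] would be null, which
   forces [psi] to vanish almost everywhere. *)
exists (~` P); split => //; apply/eqP/negP => muN.
suff : \int[rho]_s (psi s)%:E = 0 by move=> Ipsi0; rewrite Ipsi0 ltxx in Ipsi.
rewrite (@ge0_ae_eq_integral _ _ _ rho setT _ (cst 0)) ?integral0//.
  by move=> s _; rewrite lee_fin.
apply: ae_imply aes => s /(_ I) + _.
have mIs : measurable_fun setT (fun y => (\1_(~` P) (act s y))%:E : \bar R).
  exact: (measurableT_comp mIN (measurable_act mact s)).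
rewrite /K/= ge0_integralZl ?lee_fin//.
move/eqP; rewrite mule_eq0 => /orP[/eqP//|/eqP Is0]; exfalso; apply: muN.
have mPs : measurable (act s @^-1` (~` P)).
  by rewrite -[X in measurable X]setTI; exact: (measurable_act mact s).
have [_ qi] := action_quasi_invariant hact s.
apply/eqP; apply: (qi (~` P)) => // A mA AP.
rewrite /pushforward; apply/eqP; rewrite eq_le measure_ge0 andbT.
rewrite -Is0.
have -> : \int[mu]_x (\1_(~` P) (act s x))%:E = mu (act s @^-1` (~` P)).
  rewrite -[in RHS](setIT (act s @^-1` _)) -integral_indic//.
apply: le_measure; [apply: mem_set|exact: mem_set|by move=> x /AP].
by rewrite -[X in measurable X]setTI; exact: (measurable_act mact s).
Qed.

(** For almost every [x] the orbit function is [rho]-integrable, and [jessen_orbit] puts sx in the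
    set [P] of good points for almost every [s] with psi(s) > 0; [ae_transfer] then returns to
    [x]. *)
Lemma ae_cvg_orbit_integral (f : X -> R) : measurable_fun setT f ->
  {ae mu, forall x, Phi rho (fun y => `|(f y)%:E|) x < +oo} ->
  {ae mu, forall x,
    [/\ forall n, (rho_ n).-integrable setT (fun t => (f (act t x))%:E),
        rho.-integrable setT (fun t => (f (act t x))%:E) &
        \int[rho_ n]_t (f (act t x))%:E @[n --> \oo]
          --> \int[rho]_t (f (act t x))%:E]}.
Proof.
move=> mf Phif.
have mfE : measurable_fun setT (EFin \o f) by exact/measurable_EFinP.
have mfx x : measurable_fun [set: borel G] (fun t : G => (f (act t x))%:E).
  exact: (measurableT_comp mfE (measurable_orbit mact x)).
have integrable_orbit (m : {measure set (borel G) -> \bar R}) x :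
    Phi m (fun y => `|(f y)%:E|) x < +oo <->
    m.-integrable setT (fun t => (f (act t x))%:E).
  by split=> [fi|/integrableP[_]//]; apply/integrableP; split.
have mfabs : measurable_fun setT (fun y =>
  `|(f y)%:E|) by exact: measurableT_comp.
have mPhi n (g : X -> \bar R) : measurable_fun setT g -> (forall x, 0 <= g x) ->
    measurable_fun setT (Phi (rho_ n) g).
  exact: (measurable_orbit_integral hG mact (hrho_ n)).
have mPhirho (g : X -> \bar R) : measurable_fun setT g -> (forall x,
  0 <= g x) ->
    measurable_fun setT (Phi rho g).
  exact: (measurable_orbit_integral hG mact hrho).
have mp := measurable_funepos mfE; have mn := measurable_funeneg mfE.
pose a n x := \int[rho_ n]_t (f (act t x))%:E.
pose b x := \int[rho]_t (f (act t x))%:E.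
have ma n : measurable_fun setT (a n).
  rewrite /a; under eq_fun do rewrite integral_orbitE.
  by apply: emeasurable_funB; apply: mPhi.
have mb : measurable_fun setT b.
  rewrite /b; under eq_fun do rewrite integral_orbitE.
  by apply: emeasurable_funB; apply: mPhirho.
(* Only countable operations occur, so [P] is measurable. The use of [fine] loses nothing where the
   orbit functions are integrable. *)
pose P := (\bigcap_n [set x | Phi (rho_ n) (fun y => `|(f y)%:E|) x < +oo]) `&`
  \bigcap_k \bigcup_N \bigcap_(n in [set n | (N <= n)%N])
    [set x | (`|fine (b x) - fine (a n x)| <= k.+1%:R^-1)%R].
have mP : measurable P.
  apply: measurableI.
    apply: bigcapT_measurable => n; rewrite -[X in measurable X]setTI.
    by apply: emeasurable_fun_infty_o => //; exact: mPhi.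
  apply: bigcapT_measurable => k; apply: bigcupT_measurable => N.
  apply: bigcap_measurableType => n _.
  have mab : measurable_fun setT (fun x => (`|fine (b x) - fine (a n x)|)%:E :
    \bar R).
    apply/measurable_EFinP; apply: measurableT_comp => //.
    apply: measurable_funB.
      exact: (measurableT_comp (fine_measurable measurableT)).
    exact: (measurableT_comp (fine_measurable measurableT)).
  rewrite (_ : mkset _ = setT `&` [set x | (`|fine (b x) - fine (a n x)|)%:E <=
    (k.+1%:R^-1)%:E]).
    exact: emeasurable_fun_infty_c.
  by rewrite setTI; apply/seteqP; split=> x /=; rewrite lee_fin.
have [psi [ccpsi psi0 Ipsi _]] := radon_cc_pos hG closedT hrho.1.
(* The limit is constant along [G]-orbits, so the limit found at sx is also the one required there
   by the definition of [P]. *)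
have bE s x : b (act s x) = b x.
  rewrite /b !integral_orbitE.
  by rewrite !(orbit_integral_invariant mact actM (@closed_subgroupT G) hrho).
have aeP : {ae mu, forall x, P x}.
  apply: (@ae_transfer P psi mP _ psi0 Ipsi).
    by apply: continuous_measurable_real; case: ccpsi.
  apply: ae_imply Phif => x /integrable_orbit fx.
  have := jessen_orbit hG hDelta hrho clH hrho_ Hincr hD hnorm mact actM mf fx
    ccpsi psi0.
  apply: ae_imply => s + psis => /(_ psis)[Ii Ic].
  have bfin : b x \is a fin_num by exact: integrable_fin_num.
  split; first by move=> n _; apply/integrable_orbit; exact: Ii.
  move: Ic; rewrite -/(b x) -(fineK bfin) => /fine_cvgP[_ /cvgn_real_archi Ic].
  by move=> k _; have [N NP] := Ic k; exists N => // n /NP; rewrite /= bE.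
apply: ae_imply2 aeP Phif => x [P1 P2] /integrable_orbit fx.
have Ii n : (rho_ n).-integrable setT (fun t => (f (act t x))%:E).
  by apply/integrable_orbit; exact: P1.
split=> //.
have bfin : b x \is a fin_num by exact: integrable_fin_num.
rewrite -/(b x) -(fineK bfin); apply/fine_cvgP; split.
  by apply: nearW => n; apply: integrable_fin_num.
apply/cvgn_real_archi => k; have [N _ NP] := P2 k I.
by exists N => n /NP.
Qed.

End transfer.

(** * Equivalence of integrability along orbits and almost everywhere convergence *)

Theorem theorem3p13 (R : realType) (G : topologicalGroupType)
    (Delta : G -> R) (rho : {measure set (borel G) -> \bar R})
    (d : measure_display) (X : measurableType d)
    (mu : {sigma_finite_measure set X -> \bar R}) (act : G -> X -> X)
    (G_ : nat -> set G) (rho_ : nat -> {measure set (borel G) -> \bar R})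
    (hG : locally_compact_group G)
    (hDelta : modular_function [set: G] Delta)
    (hrho : right_haar_measure [set: G] rho)
    (hX : standard_borel R X)
    (hact : measured_action mu act)
    (hmu : relatively_invariant mu Delta act)
    (hG_ : forall n, closed_subgroup (G_ n))
    (G_increasing : forall n, G_ n `<=` G_ n.+1)
    (G_dense : dense (\bigcup_n G_ n))
    (MC : forall n, modular_function (G_ n) Delta)
    (hrho_ : forall n, right_haar_measure (G_ n) (rho_ n))
    (hnorm : normalized G_ rho_ rho) :
  (exists B : nat -> set X,
    [/\ forall k, measurable (B k) /\ mu (B k) < +oo,
        \bigcup_k B k = [set: X] &
        forall k, {ae mu, forall x,
          rho [set t | B k (act t x)]
            = \int[rho]_t (\1_(B k) (act t x))%:E /\
          \int[rho]_t (\1_(B k) (act t x))%:E < +oo}])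
  <->
  (forall f : X -> R, mu.-integrable [set: X] (EFin \o f) ->
    {ae mu, forall x,
      [/\ forall n, (rho_ n).-integrable (G_ n) (fun t => (f (act t x))%:E),
          rho.-integrable [set: borel G] (fun t => (f (act t x))%:E) &
          \int[rho_ n]_(t in G_ n) (f (act t x))%:E @[n --> \oo]
            --> \int[rho]_t (f (act t x))%:E]}).
Proof.
have mact : measurable_fun [set: borel G * X] (fun z :
  borel G * X => act z.1 z.2).
  by case: hact.
have sfmu : sigma_finite setT mu by exact: sigma_finiteT.
have mB_orbit (B : set X) x : measurable B ->
    measurable ([set t : G | B (act t x)] : set (borel G)).
  by move=> mB; rewrite -[X in measurable X]setTI;
    exact: (measurable_orbit mact x).
split=> [[B [mB BT aeB]] f fi|bP].
- have mf : measurable_fun setT f by apply/measurable_EFinP;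
    exact: measurable_int fi.
  have /integrableP[mfE fioo] := fi.
  have aef : {ae mu, forall x, orbit_integral act rho (fun y =>
    `|(f y)%:E|) x < +oo}.
    apply: (orbit_integral_lty hG hDelta hrho sfmu hact hmu (fun k =>
      (mB k).1) BT) => //.
    - by move=> k; apply: ae_imply (aeB k) => x [].
    - exact: measurableT_comp.
  have := ae_cvg_orbit_integral hG hDelta hrho hG_ hrho_ G_increasing MC hnorm
    sfmu hact mf aef.
  apply: ae_imply => x [Ii I Ic]; split => //.
  + by move=> n; apply: integrableS (Ii n) => //; apply: measurable_closed;
      exact: (hG_ n).1.
  + under eq_fun do rewrite (integral_subgroup (hG_ _).1 (hrho_ _).1 (Ii _)).
    exact: Ic.
(* Any exhaustion by sets of finite measure works: (b) for the indicator of [B k] contains its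
   [rho]-integrability along almost every orbit. *)
- have [B BT mB] := sfmu; exists B; split => // k; have [mBk Bkoo] := mB k.
  have Bi : mu.-integrable setT (EFin \o (\1_(B k) : X -> R)).
    apply/integrableP; split; first by apply/measurable_EFinP;
      exact: measurable_indic.
    under eq_integral do rewrite /= ger0_norm//.
    by rewrite integral_indic// setIT.
  apply: ae_imply (bP _ Bi) => x [_ /integrableP[_ Ioo] _].
  have -> : rho [set t | B k (act t x)] = \int[rho]_t (\1_(B k) (act t x))%:E.
    rewrite -[in LHS](setIT [set t : G | B k (act t x)]) -integral_indic//.
    exact: mB_orbit.
  split => //; apply: le_lt_trans Ioo; rewrite le_eqVlt; apply/orP; left.
  by apply/eqP/eq_integral => t _; rewrite /= ger0_norm.
Qed.
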